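(* \textsc{Dominator Coloring} can be solved in $O^*(16^k)$ time, where $k$ is the size of a clique modulator of the input graph (given as input).
   Context: All graphs are finite and simple; $N_G[v]=N_G(v)\cup\{v\}$. A coloring $\chi:V(G)\to C$ is proper if adjacent vertices get different colors; $|\chi|$ is the number of colors used. A vertex $v$ dominates a set $S$ if $S\subseteq N_G[v]$. A dominator coloring of $G$ is a proper coloring $\chi$ such that every vertex dominates some color class $\chi^{-1}(c)$, $c$ in the image of $\chi$. \textsc{Dominator Coloring}: given $G$ and an integer $\ell$, decide whether $G$ has a dominator coloring with at most $\ell$ colors. A clique modulator of $G$ is a set $M\subseteq V(G)$ such that $G-M$ is a clique. $O^*(\cdot)$ hides factors polynomial in the input size. *)

(* Defs.v *)
From mathcomp Require Import all_boot.
Set Implicit Arguments.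
Unset Strict Implicit.
Unset Printing Implicit Defensive.

Record sgraph (V : finType) := SGraph {
  adj :> rel V;
  adj_sym : symmetric adj;
  adj_irrefl : irreflexive adj
}.

Section Coloring.
Variables (V : finType) (G : sgraph V).

Definition closed_nbhd (v : V) : {set V} := [set u | G v u] :|: [set v].

Definition dominates (v : V) (S : {set V}) : bool := S \subset closed_nbhd v.

Definition color_class (C : finType) (chi : V -> C) (c : C) : {set V} :=
  [set u | chi u == c].

Definition colors_used (C : finType) (chi : V -> C) : {set C} :=
  [set chi v | v in V].

Definition proper_coloring (C : finType) (chi : V -> C) : Prop :=
  forall u v, G u v -> chi u <> chi v.

Definition dominator_coloring (C : finType) (chi : V -> C) : Prop :=
  proper_coloring chi /\
  forall v, exists2 c, c \in colors_used chi & dominates v (color_class chi c).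

Definition has_dominator_coloring (l : nat) : Prop :=
  exists (C : finType) (chi : V -> C),
    dominator_coloring chi /\ #|colors_used chi| <= l.

Definition clique_modulator (M : {set V}) : Prop :=
  forall u v, u \notin M -> v \notin M -> u <> v -> G u v.

End Coloring.

(** Random access machines with logarithmic cost, as in Cook and Reckhow, "Time
    bounded random access machines" (1973), on natural numbers: registers
    [X_0, X_1, ...] holding unbounded naturals, initially 0, and a read-once
    input stream.  The first argument of an instruction is its target (for
    [IStore], the register containing the target address; for [IJumpPos], the
    tested register).  Each instruction is charged the binary length of the
    values and indirect addresses it handles, so arithmetic on huge numbers is
    not free. *)

Inductive instr :=
| IConst of nat & nat
| IAdd of nat & nat & nat
| ISub of nat & nat & nat
| ILoad of nat & nat
| IStore of nat & nat
| IJumpPos of nat & nat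
| IRead of nat
| IHalt of bool.

Definition program := seq instr.

Record config := Config {
  pc : nat;
  reg : nat -> nat;
  inp : seq nat
}.

Definition bitlen (a : nat) : nat := (trunc_log 2 a).+1.

Definition set_reg (x : nat -> nat) (i a : nat) : nat -> nat :=
  fun j => if j == i then a else x j.

Definition step (I : instr) (s : config) : config :=
  let: Config p x w := s in
  match I with
  | IConst i a => Config p.+1 (set_reg x i a) w
  | IAdd i j k => Config p.+1 (set_reg x i (x j + x k)) w
  | ISub i j k => Config p.+1 (set_reg x i (x j - x k)) w
  | ILoad i j => Config p.+1 (set_reg x i (x (x j))) w
  | IStore i j => Config p.+1 (set_reg x (x i) (x j)) w
  | IJumpPos i m => Config (if 0 < x i then m else p.+1) x w
  | IRead i => Config p.+1 (set_reg x i (head 0 w)) (behead w)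
  | IHalt _ => s
  end.

Definition cost (I : instr) (s : config) : nat :=
  let: Config _ x w := s in
  match I with
  | IConst _ a => bitlen a
  | IAdd _ j k | ISub _ j k => bitlen (x j) + bitlen (x k)
  | ILoad _ j => bitlen (x j) + bitlen (x (x j))
  | IStore i j => bitlen (x i) + bitlen (x j)
  | IJumpPos i _ => bitlen (x i)
  | IRead _ => bitlen (head 0 w)
  | IHalt _ => 1
  end.

Definition is_halt (I : instr) : bool := if I is IHalt _ then true else false.

(** [halts_from P s b t]: started in [s], [P] reaches [IHalt b] at total cost
    [t].  A computation whose program counter leaves [P] is stuck and never
    halts. *)
Inductive halts_from (P : program) : config -> bool -> nat -> Prop :=
| HaltNow s b : onth P (pc s) = Some (IHalt b) ->
    halts_from P s b (cost (IHalt b) s)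
| HaltLater s I b t : onth P (pc s) = Some I -> ~~ is_halt I ->
    halts_from P (step I s) b t -> halts_from P s b (cost I s + t).

Definition halts_on (P : program) (w : seq nat) (b : bool) (t : nat) : Prop :=
  halts_from P (Config 0 (fun=> 0) w) b t.

Definition encode (n : nat) (G : sgraph 'I_n) (l : nat) (M : {set 'I_n}) :
    seq nat :=
  [:: n; l] ++ [seq nat_of_bool (G u v) | u <- enum 'I_n, v <- enum 'I_n]
            ++ [seq nat_of_bool (v \in M) | v <- enum 'I_n].

Definition input_size (w : seq nat) : nat := \sum_(a <- w) bitlen a.

(* Main.v *)
(** Let Q be the complement of the modulator M, k = |M| and q = |Q|.  The
    vertices of the clique Q have distinct colors, so a coloring with l colors
    consists of q classes, one for each vertex of Q, and of at most l - q
    classes inside M.  Choose these classes one after the other; the only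
    information to be kept is the set X of colored vertices and the set D of
    vertices that dominate a class chosen so far, and the next class is given
    by its trace S on M.  If q > k, some vertex of Q forms a class by itself and
    is dominated by all of Q, so D need only record vertices of M; if q <= k,
    then D ranges over subsets of at most 2k vertices.  In both cases there are
    at most 2^(k + 2k + k) = 16^k triples (X, D, S), and running through all of
    them for each class fills a table of reachable pairs (X, D).

    The machine is programmed in a small language of bounded loops, whose
    programs are total functions on states; the running time is read off the
    nesting of the loops, and every stored value stays below an explicit cap, so
    that each instruction has polynomial logarithmic cost. *)

Require Import Defs.
From mathcomp Require Import all_boot zify.
Set Implicit Arguments.
Unset Strict Implicit.
Unset Printing Implicit Defensive.

(** * Choosing the classes one by one *)

Section Slots.

Variables (n : nat) (G : sgraph 'I_n) (M A : {set 'I_n}).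

(* If there are more clique vertices than vertices of M, the former need not be
   recorded in D: some clique vertex is a class by itself. *)
Definition tracked : {set 'I_n} :=
  [set v | (v \in M) || (#|~: M| <= #|M|)].

Definition independent (S : {set 'I_n}) : bool :=
  [forall u, forall v, (u \in S) && (v \in S) ==> ~~ G u v].

Definition slot_ok (j : 'I_n) (S : {set 'I_n}) : bool :=
  [&& S \subset j |: M, (j \notin M) ==> (j \in S),
      (S != set0) ==> ((j \notin M) || (j \in A)) & independent S].

Definition dominators (S : {set 'I_n}) : {set 'I_n} :=
  [set v | (S != set0) && dominates G v S].

(* Vertices are processed in decreasing order, and [j] is the last one processed.
   A vertex outside M opens its own class, a vertex of A may open a class inside
   M, and the other vertices open no class ([S] is empty). *)
Inductive reach : nat -> {set 'I_n} -> {set 'I_n} -> Prop :=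
| ReachInit : reach n set0 (~: tracked)
| ReachStep (j : 'I_n) X D S : reach j.+1 X D -> slot_ok j S ->
    [disjoint S & X] -> reach j (X :|: S) (D :|: dominators S).

Lemma reach_inv k X D : reach k X D ->
  [/\ k = n, X = set0 & D = ~: tracked] \/
  exists (j : 'I_n) X0 D0 S, [/\ k = j, reach j.+1 X0 D0,
    slot_ok j S /\ [disjoint S & X0], X = X0 :|: S & D = D0 :|: dominators S].
Proof.
by case=> [|j X0 D0 S r ok dis]; [left | right; exists j, X0, D0, S].
Qed.

Lemma reach_coloring j X D : reach j X D ->
  exists f : 'I_n -> 'I_n,
    [/\ forall v, v \in X -> j <= f v,
        forall i : 'I_n, j <= i -> slot_ok i [set v in X | f v == i] &
        forall v, v \in D -> v \in tracked ->
          exists2 i : 'I_n, j <= i & v \in dominators [set v in X | f v == i]].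
Proof.
elim=> [|{}j {}X {}D S _ [f [fX fok fD]] Sok dSX].
  exists id; split=> [v|i|v]; rewrite ?inE //.
    by rewrite leqNgt ltn_ord.
  by move=> /negP.
pose f' v := if v \in S then j else f v.
have cl (i : 'I_n) : j <= i -> [set v in X :|: S | f' v == i] =
    if i == j then S else [set v in X | f v == i].
  move=> leji; apply/setP => v; rewrite /f' !inE.
  case: ifP => [vS|vS].
    rewrite orbT /= eq_sym; case: ifP => _; rewrite ?vS ?inE //.
    by rewrite (disjointFr dSX vS).
  rewrite orbF; case: ifP => [/eqP->|_]; rewrite ?inE // vS.
  by apply/andP => -[/fX lt1 /eqP eqf]; rewrite eqf ltnn in lt1.
exists f'; split.
- move=> v; rewrite inE /f'; case: ifP => // _; rewrite orbF.
  by move/fX/ltnW.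
- move=> i leji; rewrite cl //; case: eqP => [-> //|/eqP nij]; apply: fok.
  by rewrite ltn_neqAle eq_sym leji andbT.
- move=> v; rewrite inE => /orP[vD vt|vS _].
    have [i lti vi] := fD v vD vt; exists i; first exact: ltnW.
    rewrite cl ?(ltnW lti) // ifF //.
    by apply/eqP => eij; rewrite eij ltnn in lti.
  by exists j => //; rewrite cl // eqxx.
Qed.

Lemma coloring_reach (f : 'I_n -> 'I_n) :
  (forall i, slot_ok i [set v | f v == i]) ->
  reach 0 setT (~: tracked :|: \bigcup_i dominators [set v | f v == i]).
Proof.
move=> fok.
have gen k : k <= n -> reach (n - k) [set v | n - k <= f v]
  (~: tracked :|: \bigcup_(i : 'I_n | n - k <= i) dominators [set v | f v == i]).
  elim: k => [_|k IHk ltkn].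
    rewrite subn0 big_pred0; last by move=> i; rewrite leqNgt ltn_ord.
    rewrite setU0 (_ : [set v | _] = set0); first exact: ReachInit.
    by apply/setP=> v; rewrite !inE leqNgt ltn_ord.
  have ltj : n - k.+1 < n by lia.
  pose j := Ordinal ltj.
  have ej : n - k = j.+1 by rewrite /=; lia.
  have := IHk (ltnW ltkn); rewrite ej => /ReachStep /(_ (fok j)) /= r.
  have -> : [set v | n - k.+1 <= f v] =
      [set v | j < f v] :|: [set v | f v == j].
    by apply/setP=> v; rewrite !inE -val_eqE /=; lia.
  rewrite (bigD1 j) //= [dominators _ :|: _]setUC setUA.
  rewrite (eq_bigl (fun i : 'I_n => n - k.+1 < i)).
    apply: r; rewrite -setI_eq0; apply/eqP/setP=> v; rewrite !inE.
    by apply/andP => -[/eqP->]; rewrite ltnn.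
  by move=> i; rewrite -val_eqE /=; lia.
have := gen n (leqnn n); rewrite subnn (_ : [set v | _] = setT) //.
Qed.

End Slots.

Section Spec.

Variables (n : nat) (G : sgraph 'I_n) (M A : {set 'I_n}) (l : nat).
Hypothesis cliqueM : clique_modulator G M.
Hypothesis subAM : A \subset M.
Hypothesis cardA : #|A| = minn #|M| (l - #|~: M|).

Lemma clique_injective (C : finType) (chi : 'I_n -> C) :
  proper_coloring G chi -> {in ~: M &, injective chi}.
Proof.
move=> pc u v; rewrite !inE => uM vM eqc; apply/eqP/negP => /negP/eqP nuv.
exact: pc (cliqueM uM vM nuv) eqc.
Qed.

Lemma coloring_card (C : finType) (chi : 'I_n -> C) :
  proper_coloring G chi -> #|~: M| <= #|colors_used chi|.
Proof.
move=> pc; rewrite -(card_in_imset (clique_injective pc)).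
by apply: subset_leq_card; apply/subsetP => c /imsetP[v _ ->]; apply: imset_f.
Qed.

(* The classes avoiding the clique are renamed after distinct elements of A,
   the others after their unique vertex in the clique. *)
Lemma normalize_coloring (C : finType) (chi : 'I_n -> C) :
  proper_coloring G chi -> #|colors_used chi| <= l ->
  exists f : 'I_n -> 'I_n,
    [/\ forall u v, (f u == f v) = (chi u == chi v),
        forall u, u \notin M -> f u = u & forall u, (f u \notin M) || (f u \in A)].
Proof.
move=> pc lel; pose K := colors_used chi :\: chi @: (~: M).
have cK : #|K| <= #|A|.
  rewrite cardA leq_min; apply/andP; split.
    apply: leq_trans (leq_imset_card chi M); apply: subset_leq_card.
    apply/subsetP => c; rewrite inE => /andP[+ /imsetP[v _ ec]]; rewrite {c}ec.
    move=> h; apply: imset_f; apply: contraR h => h; apply: imset_f.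
    by rewrite inE.
  rewrite cardsD (setIidPr _) ?(card_in_imset (clique_injective pc)) ?leq_sub2r //.
  by apply/subsetP => c /imsetP[v _ ->]; apply: imset_f.
pose f v := if [pick u | (u \notin M) && (chi u == chi v)] is Some u then u
            else nth v (enum A) (index (chi v) (enum K)).
have fcase v : (f v \notin M /\ chi (f v) = chi v) \/
    [/\ chi v \in K, f v \in A &
        index (f v) (enum A) = index (chi v) (enum K)].
  rewrite /f; case: pickP => [u /andP[uM /eqP ec]|h]; [by left | right].
  have vK : chi v \in K.
    rewrite inE; apply/andP; split; last exact: imset_f.
    apply/imsetP => -[u uM ec].
    by have := h u; rewrite -in_setC uM ec eqxx.
  have lt : index (chi v) (enum K) < size (enum A).
    rewrite -cardE; apply: leq_trans cK.
    by rewrite [X in _ < X]cardE index_mem mem_enum.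
  split=> //; first by rewrite -mem_enum mem_nth.
  by rewrite index_uniq // enum_uniq.
exists f; split=> [u v|u uM|u].
- apply/eqP/eqP => [e|e].
    case: (fcase u) (fcase v) => [[uM eu]|[uK uA hu]].
      case=> [[vM ev]|[vK vA hv]]; first by rewrite -eu -ev e.
      by rewrite e (subsetP subAM) in uM.
    case=> [[vM ev]|[vK vA hv]].
      by rewrite -e (subsetP subAM) in vM.
    have := hu; rewrite e hv => /esym ei.
    by rewrite -(nth_index (chi u) (_ : chi u \in enum K)) ?mem_enum // ei
               nth_index ?mem_enum.
  case: (fcase u) (fcase v) => [[uM eu]|[uK uA hu]].
    case=> [[vM ev]|[vK vA hv]].
      by apply: (clique_injective pc); rewrite ?inE // eu ev.
    move: vK; rewrite inE => /andP[/negP[]].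
    by rewrite -e -eu imset_f // inE.
  case=> [[vM ev]|[vK vA hv]].
    move: uK; rewrite inE => /andP[/negP[]].
    by rewrite e -ev imset_f // inE.
  have ei := hu; rewrite e -hv in ei.
  by rewrite -(nth_index u (_ : f u \in enum A)) ?mem_enum // ei
             nth_index ?mem_enum.
- case: (fcase u) => [[fM ec]|[]].
    by apply: (clique_injective pc); rewrite ?inE.
  by rewrite inE => /andP[/negP[]]; rewrite imset_f // inE.
- by case: (fcase u) => [[-> //]|[_ -> _]]; rewrite orbT.
Qed.

Lemma has_coloring_reach : has_dominator_coloring G l ->
  #|~: M| <= l /\ reach G M A 0 setT setT.
Proof.
case=> C [chi [[pc dc] lel]]; split.
  exact: leq_trans (coloring_card pc) lel.
have [f [fchi fM fA]] := normalize_coloring pc lel.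
have fok i : slot_ok G M A i [set v | f v == i].
  apply/and4P; split.
  - apply/subsetP => v; rewrite !inE => /eqP fv; case: (boolP (v \in M)).
      by rewrite orbT.
    by move=> /fM; rewrite fv => ->; rewrite eqxx.
  - by apply/implyP => /fM; rewrite inE => ->.
  - apply/implyP => /set0Pn[v]; rewrite inE => /eqP <-; exact: fA.
  - apply/forallP => u; apply/forallP => v; apply/implyP; rewrite !inE.
    case/andP=> /eqP fu /eqP fv; apply/negP => /pc /eqP; rewrite -fchi fu fv.
    by rewrite eqxx.
have := coloring_reach fok.
rewrite (_ : _ :|: _ = setT) //; apply/setP => v; rewrite in_setT in_setU.
apply/orP; right; have [c /imsetP[u _ ->] dv] := dc v.
apply/bigcupP; exists (f u) => //; rewrite inE.
have -> : [set w | f w == f u] = color_class chi (chi u).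
  by apply/setP => w; rewrite !inE fchi.
by rewrite dv andbT; apply/set0Pn; exists u; rewrite inE.
Qed.

Lemma reach_has_coloring : #|~: M| <= l -> reach G M A 0 setT setT ->
  has_dominator_coloring G l.
Proof.
move=> leql /reach_coloring[f [_ fok fD]].
have {}fok i : slot_ok G M A i [set v | f v == i].
  have := fok i (leq0n _); rewrite (_ : [set v in _ | _] = [set v | f v == i]) //.
  by apply/setP => v; rewrite !inE.
have {}fD v : v \in tracked M -> exists i, v \in dominators G [set v | f v == i].
  move=> vt; have [i _ vi] := fD v (in_setT _) vt; exists i; move: vi.
  rewrite (_ : [set v in _ | _] = [set v | f v == i]) //.
  by apply/setP => u; rewrite !inE.
have fA v : f v \in ~: M :|: A.
  have /and4P[_ _ /implyP h _] := fok (f v); rewrite !inE; apply: h.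
  by apply/set0Pn; exists v; rewrite inE.
have fM u : u \notin M -> f u = u.
  by move=> uM; have /and4P[_ /implyP/(_ uM) + _ _] := fok u; rewrite inE => /eqP.
have fdom v i : v \in dominators G [set v | f v == i] ->
    exists2 c, c \in colors_used f & dominates G v (color_class f c).
  rewrite inE => /andP[/set0Pn[w]]; rewrite inE => /eqP fw dv.
  by exists i => //; rewrite -fw; apply: imset_f.
exists 'I_n, f; split; first split.
- move=> u v Guv e; have /and4P[_ _ _ /forallP/(_ u)/forallP/(_ v)] := fok (f u).
  by rewrite !inE e eqxx Guv.
- move=> v; case: (boolP (v \in tracked M)) => [/fD[i]|]; first exact: fdom.
  rewrite inE negb_or -ltnNge => /andP[vM ltMQ].
  have /existsP[u /andP[uM /forall_inP uS]] : [exists u : 'I_n, (u \notin M) &&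
      [forall w in M, f w != u]].
    apply/contraT => /existsPn nex; move: ltMQ; rewrite ltnNge => /negP[].
    apply: leq_trans (leq_imset_card f M); apply: subset_leq_card.
    apply/subsetP => u; rewrite inE => uM; have := nex u; rewrite uM /=.
    rewrite negb_forall_in => /existsP[w /andP[wM]]; rewrite negbK => /eqP <-.
    exact: imset_f.
  exists u; first by rewrite -(fM u uM); apply: imset_f.
  apply/subsetP => w; rewrite !inE => /eqP fw.
  have wM : w \notin M by apply/negP => /uS; rewrite fw eqxx.
  rewrite (fM _ wM) in fw; rewrite {w wM}fw.
  by case: (u =P v) => [|/eqP nuv]; rewrite ?orbT // orbF cliqueM //; apply/eqP; rewrite eq_sym.
- apply: (@leq_trans #|~: M :|: A|).
    by apply: subset_leq_card; apply/subsetP => c /imsetP[v _ ->].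
  rewrite cardsU; apply: leq_trans (leq_subr _ _) _; rewrite cardA; lia.
Qed.

Lemma reachP : has_dominator_coloring G l <->
  #|~: M| <= l /\ reach G M A 0 setT setT.
Proof.
split; [exact: has_coloring_reach | by case; apply: reach_has_coloring].
Qed.

End Spec.

(** * A loop language and its compilation *)

Inductive expr :=
| EBit of bool
| EVar of nat
| EAdd of expr & expr
| ESub of expr & expr
| EGet of nat & expr.

Inductive com :=
| CSkip
| CSet of nat & expr
| CPut of nat & expr & expr
| CRead of nat
| CGrow
| CSeq of com & com
| CIf of expr & com & com
| CFor of nat & nat & com.

(* [cp] is the cap: all values are at most [cp], reading and [CGrow] raise it, and
   [EAdd] saturates at it. *)
Record state := State {
  vr : nat -> nat;
  ar : nat -> nat -> nat;
  cp : nat;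
  ip : seq nat
}.

Definition setv (s : state) (x a : nat) : state :=
  State (fun y => if eqn y x then a else vr s y) (ar s) (cp s) (ip s).

Definition puta (s : state) (A i a : nat) : state :=
  State (vr s) (fun B j => if eqn B A && eqn j i then a else ar s B j)
        (cp s) (ip s).

Fixpoint eval (s : state) (e : expr) : nat :=
  match e with
  | EBit b => b
  | EVar x => vr s x
  | EAdd e1 e2 => minn (eval s e1 + eval s e2) (cp s)
  | ESub e1 e2 => eval s e1 - eval s e2
  | EGet A e1 => ar s A (eval s e1)
  end.

Fixpoint loop (f : state -> state) (x k : nat) (s : state) : state :=
  if k is k'.+1 then loop f x k' (f (setv s x k')) else s.

Fixpoint run (c : com) (s : state) : state :=
  match c with
  | CSkip => s
  | CSet x e => setv s x (eval s e)
  | CPut A e1 e2 => puta s A (eval s e1) (eval s e2)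
  | CRead x =>
      State (fun y => if eqn y x then head 0 (ip s) else vr s y) (ar s)
            (cp s + head 0 (ip s)) (behead (ip s))
  | CGrow => State (vr s) (ar s) (cp s + cp s) (ip s)
  | CSeq c1 c2 => run c2 (run c1 s)
  | CIf e c1 c2 => if 0 < eval s e then run c1 s else run c2 s
  | CFor x y c1 => loop (run c1) x (vr s y) (setv s x (vr s y))
  end.

Fixpoint mod_vars (c : com) : seq nat :=
  match c with
  | CSet x _ | CRead x => [:: x]
  | CSeq c1 c2 | CIf _ c1 c2 => mod_vars c1 ++ mod_vars c2
  | CFor x _ c1 => x :: mod_vars c1
  | _ => [::]
  end.

Fixpoint mod_arrays (c : com) : seq nat :=
  match c with
  | CPut A _ _ => [:: A]
  | CSeq c1 c2 | CIf _ c1 c2 => mod_arrays c1 ++ mod_arrays c2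
  | CFor _ _ c1 => mod_arrays c1
  | _ => [::]
  end.

Lemma loop_ind (f : state -> state) (x k : nat) (I : nat -> state -> Prop) s :
  I k s -> (forall j s', j < k -> I j.+1 s' -> I j (f (setv s' x j))) ->
  I 0 (loop f x k s).
Proof.
elim: k s => [|k IHk] s Is step //=.
apply: IHk => [|j s' ltjk]; first exact: step.
by apply: step; apply: ltnW.
Qed.

Lemma eqn_eq x y : eqn x y = (x == y). Proof. by []. Qed.

Lemma run_var c s y : y \notin mod_vars c -> vr (run c s) y = vr s y.
Proof.
elim: c s => [|x e|A e1 e2|x||c1 IH1 c2 IH2|e c1 IH1 c2 IH2|x z c1 IH1] s //=.
- by rewrite inE => /negPf; rewrite eqn_eq => ->.
- by rewrite inE => /negPf; rewrite eqn_eq => ->.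
- by rewrite mem_cat negb_or => /andP[h1 h2]; rewrite IH2 ?IH1.
- by rewrite mem_cat negb_or => /andP[h1 h2]; case: ifP => _; rewrite ?IH1 ?IH2.
rewrite inE negb_or => /andP[/negPf h1 h2].
apply: (@loop_ind _ _ _ (fun _ s' => vr s' y = vr s y)) => /=.
  by rewrite eqn_eq h1.
by move=> j s' _ <-; rewrite IH1 //= eqn_eq h1.
Qed.

Lemma run_arr c s A i : A \notin mod_arrays c -> ar (run c s) A i = ar s A i.
Proof.
elim: c s => [|x e|B e1 e2|x||c1 IH1 c2 IH2|e c1 IH1 c2 IH2|x z c1 IH1] s //=.
- by rewrite inE => /negPf; rewrite eqn_eq => ->.
- by rewrite mem_cat negb_or => /andP[h1 h2]; rewrite IH2 ?IH1.
- by rewrite mem_cat negb_or => /andP[h1 h2]; case: ifP => _; rewrite ?IH1 ?IH2.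
move=> h; apply: (@loop_ind _ _ _ (fun _ s' => ar s' A i = ar s A i)) => //=.
by move=> j s' _ <-; rewrite IH1.
Qed.

Lemma run_cp_ge c s : cp s <= cp (run c s).
Proof.
elim: c s => [|x e|B e1 e2|x||c1 IH1 c2 IH2|e c1 IH1 c2 IH2|x z c1 IH1] s //=.
- exact: leq_addr.
- exact: leq_addr.
- exact: leq_trans (IH1 _) (IH2 _).
- by case: ifP.
apply: (@loop_ind _ _ _ (fun _ s' => cp s <= cp s')) => //=.
by move=> j s' _ h; apply: leq_trans (IH1 _).
Qed.

Fixpoint no_grow (c : com) : bool :=
  match c with
  | CGrow => false
  | CSeq c1 c2 | CIf _ c1 c2 => no_grow c1 && no_grow c2
  | CFor _ _ c1 => no_grow c1
  | _ => true
  end.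

Lemma run_cp_le c s : no_grow c ->
  cp (run c s) + sumn (ip (run c s)) <= cp s + sumn (ip s).
Proof.
elim: c s => [|x e|B e1 e2|x||c1 IH1 c2 IH2|e c1 IH1 c2 IH2|x z c1 IH1] s //=.
- by move=> _; case: (ip s) => [|a w] /=; lia.
- by case/andP=> h1 h2; apply: leq_trans (IH2 _ h2) (IH1 _ h1).
- by case/andP=> h1 h2; case: ifP => _; [apply: IH1 | apply: IH2].
move=> h; apply: (@loop_ind _ _ _ (fun _ s' =>
  cp s' + sumn (ip s') <= cp s + sumn (ip s))) => //=.
by move=> j s' _ h'; apply: leq_trans (IH1 _ h) _.
Qed.

Definition same_outside (V A : seq nat) (s s' : state) : Prop :=
  [/\ forall y, y \notin V -> vr s' y = vr s y,
      forall B i, B \notin A -> ar s' B i = ar s B i & cp s <= cp s'].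

Lemma same_outside_run c s : same_outside (mod_vars c) (mod_arrays c) s (run c s).
Proof.
by split=> [y|B i|]; [apply: run_var | apply: run_arr | apply: run_cp_ge].
Qed.

Lemma run_for (x y : nat) (c : com) (s : state) (I : nat -> state -> Prop) :
  I (vr s y) (setv s x (vr s y)) ->
  (forall j s', j < vr s y ->
     same_outside (x :: mod_vars c) (mod_arrays c) s s' ->
     I j.+1 s' -> I j (run c (setv s' x j))) ->
  I 0 (run (CFor x y c) s).
Proof.
move=> I0 step /=.
pose J j s' := same_outside (x :: mod_vars c) (mod_arrays c) s s' /\ I j s'.
suff: J 0 (loop (run c) x (vr s y) (setv s x (vr s y))) by case.
apply: loop_ind => [|j s' ltj [so Ij]].
  split=> //; split=> //= z; rewrite inE negb_or => /andP[/negPf h _].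
  by rewrite eqn_eq h.
split; last exact: step.
case: so => sv sa sc; split=> [z hz|B i hB|].
- rewrite run_var /= ?eqn_eq.
    by move: (hz); rewrite inE negb_or => /andP[/negPf -> _]; apply: sv.
  by move: hz; rewrite inE negb_or => /andP[].
- by rewrite run_arr //= sa.
- exact: leq_trans sc (run_cp_ge c (setv s' x j)).
Qed.

Definition bounded (s : state) : Prop :=
  [/\ forall v, vr s v <= cp s, forall A i, ar s A i <= cp s & 0 < cp s].

Lemma bounded_eval s e : bounded s -> eval s e <= cp s.
Proof.
case=> bv ba bc; elim: e => [b|x|e1 IH1 e2 IH2|e1 IH1 e2 IH2|A e IH] //=.
- exact: leq_trans (leq_b1 _) bc.
- exact: geq_minr.
- exact: leq_trans (leq_subr _ _) IH1.
Qed.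

Lemma bounded_setv s x a : bounded s -> a <= cp s -> bounded (setv s x a).
Proof. by case=> bv ba bc ha; split=> //= v; case: ifP. Qed.

Lemma bounded_run c s : bounded s -> bounded (run c s).
Proof.
elim: c s => [|x e|B e1 e2|x||c1 IH1 c2 IH2|e c1 IH1 c2 IH2|x z c1 IH1] s //= bs.
- exact/bounded_setv/bounded_eval.
- have h := bounded_eval e2 bs; case: bs => bv ba bc; split=> //= A i.
  by case: ifP.
- case: bs => bv ba bc; split=> /= [v|A i|]; last exact: ltn_addr.
    by case: ifP => _; [apply: leq_addl | apply: leq_trans (leq_addr _ _)].
  exact: leq_trans (leq_addr _ _).
- case: bs => bv ba bc; split=> /= [v|A i|]; last exact: ltn_addr.
    exact: leq_trans (leq_addr _ _).
  exact: leq_trans (leq_addr _ _).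
- exact/IH2/IH1.
- by case: ifP => _; [apply: IH1 | apply: IH2].
pose J (j : nat) s' := bounded s' /\ (cp s <= cp s').
suff: J 0 (loop (run c1) x (vr s z) (setv s x (vr s z))) by case.
have [bv _ _] := bs.
have lek := bv z.
apply: (@loop_ind _ _ _ J); first by split=> //; apply: bounded_setv.
move=> j s' ltj [bs' les']; split; last exact: leq_trans les' (run_cp_ge c1 (setv s' x j)).
apply/IH1/bounded_setv => //; lia.
Qed.

(* Registers 0 to 30 hold the variables, 31 the cap, 32 to 63 the evaluation
   stack, and entry [i] of array [A] is register 64 * (i + 1) + A. *)
Definition scratch (d : nat) := 32 + d.
Definition capreg := 31.

Definition addr_code (A d : nat) : seq instr :=
  nseq 6 (IAdd (scratch d) (scratch d) (scratch d)) ++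
  [:: IConst (scratch d.+1) (64 + A);
      IAdd (scratch d) (scratch d) (scratch d.+1)].

Arguments addr_code : simpl never.

Lemma size_addr_code A d : size (addr_code A d) = 8.
Proof. by []. Qed.

Fixpoint ecomp (e : expr) (d : nat) : seq instr :=
  match e with
  | EBit b => [:: IConst (scratch d) b]
  | EVar x => [:: IConst (scratch d) 0; IAdd (scratch d) x (scratch d)]
  | EAdd e1 e2 => ecomp e1 d ++ ecomp e2 d.+1 ++
      [:: IAdd (scratch d) (scratch d) (scratch d.+1);
          ISub (scratch d.+1) (scratch d) capreg;
          ISub (scratch d) (scratch d) (scratch d.+1)]
  | ESub e1 e2 => ecomp e1 d ++ ecomp e2 d.+1 ++
      [:: ISub (scratch d) (scratch d) (scratch d.+1)]
  | EGet A e1 => ecomp e1 d ++ addr_code A d ++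
      [:: ILoad (scratch d) (scratch d)]
  end.

Fixpoint esize (e : expr) : nat :=
  match e with
  | EBit _ => 1
  | EVar _ => 2
  | EAdd e1 e2 => esize e1 + (esize e2 + 3)
  | ESub e1 e2 => esize e1 + (esize e2 + 1)
  | EGet _ e1 => esize e1 + 9
  end.

Lemma size_ecomp e d : size (ecomp e d) = esize e.
Proof.
elim: e d => [b|x|e1 IH1 e2 IH2|e1 IH1 e2 IH2|A e IH] d //=;
  by rewrite !size_cat ?size_addr_code ?IH1 ?IH2 ?IH.
Qed.

Fixpoint wfe (e : expr) (d : nat) : bool :=
  match e with
  | EBit _ => d < 31
  | EVar x => (x < 31) && (d < 31)
  | EAdd e1 e2 | ESub e1 e2 => wfe e1 d && wfe e2 d.+1
  | EGet A e1 => (A < 64) && wfe e1 d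
  end.

Fixpoint csize (c : com) : nat :=
  match c with
  | CSkip => 0
  | CSet _ e => esize e + 2
  | CPut _ e1 e2 => esize e1 + (8 + (esize e2 + 1))
  | CRead _ => 2
  | CGrow => 1
  | CSeq c1 c2 => csize c1 + csize c2
  | CIf e c1 c2 => esize e + (1 + (csize c2 + (2 + csize c1)))
  | CFor _ _ c1 => 7 + (csize c1 + 2)
  end.

Fixpoint comp (c : com) (p : nat) : seq instr :=
  match c with
  | CSkip => [::]
  | CSet x e => ecomp e 0 ++
      [:: IConst (scratch 1) 0; IAdd x (scratch 0) (scratch 1)]
  | CPut A e1 e2 => ecomp e1 0 ++ addr_code A 0 ++ ecomp e2 1 ++
      [:: IStore (scratch 0) (scratch 1)]
  | CRead x => [:: IRead x; IAdd capreg capreg x]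
  | CGrow => [:: IAdd capreg capreg capreg]
  | CSeq c1 c2 => comp c1 p ++ comp c2 (p + csize c1)
  | CIf e c1 c2 =>
      let p2 := p + esize e + 1 in
      let p1 := p2 + csize c2 + 2 in
      ecomp e 0 ++ [:: IJumpPos (scratch 0) p1] ++ comp c2 p2 ++
      [:: IConst (scratch 0) 1; IJumpPos (scratch 0) (p1 + csize c1)] ++
      comp c1 p1
  | CFor x y c1 =>
      [:: IConst (scratch 0) 0; IAdd x y (scratch 0);
          IJumpPos x (p + 5);
          IConst (scratch 0) 1;
          IJumpPos (scratch 0) (p + 7 + csize c1 + 2);
          IConst (scratch 0) 1; ISub x x (scratch 0)] ++
      comp c1 (p + 7) ++
      [:: IConst (scratch 0) 1; IJumpPos (scratch 0) (p + 2)]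
  end.

Lemma size_comp c p : size (comp c p) = csize c.
Proof.
elim: c p => [|x e|B e1 e2|x||c1 IH1 c2 IH2|e c1 IH1 c2 IH2|x z c1 IH1] p //=;
  by rewrite !size_cat /= ?size_cat /= ?size_addr_code ?size_ecomp ?IH1 ?IH2.
Qed.

Fixpoint wf (c : com) : bool :=
  match c with
  | CSkip | CGrow => true
  | CSet x e => (x < 31) && wfe e 0
  | CPut A e1 e2 => [&& A < 64, wfe e1 0 & wfe e2 1]
  | CRead x => x < 31
  | CSeq c1 c2 => wf c1 && wf c2
  | CIf e c1 c2 => [&& wfe e 0, wf c1 & wf c2]
  | CFor x y c1 => [&& x < 31, y < 31, x \notin mod_vars c1 & wf c1]
  end.

Fixpoint loop_time (f : state -> state) (t : state -> nat) (x k : nat)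
    (s : state) : nat :=
  if k is k'.+1 then
    5 + t (setv s x k') + loop_time f t x k' (f (setv s x k'))
  else 3.

Fixpoint time (c : com) (s : state) : nat :=
  match c with
  | CSkip => 0
  | CSet _ e => esize e + 2
  | CPut _ e1 e2 => esize e1 + (8 + (esize e2 + 1))
  | CRead _ => 2
  | CGrow => 1
  | CSeq c1 c2 => time c1 s + time c2 (run c1 s)
  | CIf e c1 c2 =>
      esize e + (if 0 < eval s e then 1 + time c1 s else 1 + (time c2 s + 2))
  | CFor x y c1 =>
      2 + loop_time (run c1) (time c1) x (vr s y) (setv s x (vr s y))
  end.

Fixpoint loop_vars (c : com) : seq nat :=
  match c with
  | CSeq c1 c2 | CIf _ c1 c2 => loop_vars c1 ++ loop_vars c2
  | CFor _ y c1 => y :: loop_vars c1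
  | _ => [::]
  end.

Fixpoint nesting (y : nat) (c : com) : nat :=
  match c with
  | CSeq c1 c2 | CIf _ c1 c2 => maxn (nesting y c1) (nesting y c2)
  | CFor _ z c1 => (z == y) + nesting y c1
  | _ => 0
  end.

Fixpoint weight (c : com) : nat :=
  match c with
  | CSkip => 0
  | CSet _ e => esize e + 2
  | CPut _ e1 e2 => esize e1 + (8 + (esize e2 + 1))
  | CRead _ => 2
  | CGrow => 1
  | CSeq c1 c2 => weight c1 + weight c2
  | CIf e c1 c2 => esize e + (3 + (weight c1 + weight c2))
  | CFor _ _ c1 => 10 + weight c1
  end.

Lemma time_bound (y z a b : nat) (V : seq nat) (c : com) (s : state) :
  0 < a -> 0 < b -> {subset mod_vars c <= V} ->
  {subset loop_vars c <= [:: y; z]} -> y != z ->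
  (forall u, u \in loop_vars c -> u \notin V) ->
  (y \in loop_vars c -> vr s y <= a) -> (z \in loop_vars c -> vr s z <= b) ->
  time c s <= weight c * (a ^ nesting y c * b ^ nesting z c).
Proof.
move=> a0 b0 + + nyz.
have pos m1 m2 : 0 < a ^ m1 * b ^ m2 by rewrite muln_gt0 !expn_gt0 a0 b0.
have mono w m1 m2 m1' m2' : m1 <= m1' -> m2 <= m2' ->
    w * (a ^ m1 * b ^ m2) <= w * (a ^ m1' * b ^ m2').
  by move=> h1 h2; rewrite !leq_mul // leq_pexp2l.
elim: c s => [|x e|B e1 e2|x||c1 IH1 c2 IH2|e c1 IH1 c2 IH2|x u c1 IH1] s /=;
  rewrite ?muln1 //.
- move=> mV lV nV ya zb.
  have mV1 : {subset mod_vars c1 <= V} by move=> ? h; apply: mV; rewrite mem_cat h.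
  have mV2 : {subset mod_vars c2 <= V} by move=> ? h; apply: mV; rewrite mem_cat h orbT.
  have sub1 : {subset loop_vars c1 <= loop_vars c1 ++ loop_vars c2}.
    by move=> ? h; rewrite mem_cat h.
  have sub2 : {subset loop_vars c2 <= loop_vars c1 ++ loop_vars c2}.
    by move=> ? h; rewrite mem_cat h orbT.
  have keep v : v \in loop_vars c2 -> vr (run c1 s) v = vr s v.
    move=> hv; apply: run_var; apply/negP => /mV1 h.
    by have := nV v (sub2 _ hv); rewrite h.
  have t1 : time c1 s <= weight c1 * (a ^ nesting y c1 * b ^ nesting z c1).
    by apply: IH1 => // [v /sub1/lV|v /sub1/nV|/sub1/ya|/sub1/zb].
  have t2 : time c2 (run c1 s) <= weight c2 * (a ^ nesting y c2 * b ^ nesting z c2).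
    apply: IH2 => // [v /sub2/lV|v /sub2/nV|h|h] //; rewrite keep //.
      exact/ya/sub2.
    exact/zb/sub2.
  rewrite mulnDl leq_add //; [apply: leq_trans t1 _ | apply: leq_trans t2 _];
    by apply: mono; rewrite ?leq_maxl ?leq_maxr.
- move=> mV lV nV ya zb.
  have mV1 : {subset mod_vars c1 <= V} by move=> ? h; apply: mV; rewrite mem_cat h.
  have mV2 : {subset mod_vars c2 <= V} by move=> ? h; apply: mV; rewrite mem_cat h orbT.
  have sub1 : {subset loop_vars c1 <= loop_vars c1 ++ loop_vars c2}.
    by move=> ? h; rewrite mem_cat h.
  have sub2 : {subset loop_vars c2 <= loop_vars c1 ++ loop_vars c2}.
    by move=> ? h; rewrite mem_cat h orbT.
  have t1 : time c1 s <= weight c1 * (a ^ nesting y c1 * b ^ nesting z c1).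
    by apply: IH1 => // [v /sub1/lV|v /sub1/nV|/sub1/ya|/sub1/zb].
  have t2 : time c2 s <= weight c2 * (a ^ nesting y c2 * b ^ nesting z c2).
    by apply: IH2 => // [v /sub2/lV|v /sub2/nV|/sub2/ya|/sub2/zb].
  set E := a ^ _ * b ^ _.
  have E0 : 0 < E by apply: pos.
  have {}t1 : time c1 s <= weight c1 * E.
    by apply: leq_trans t1 _; apply: mono; rewrite leq_maxl.
  have {}t2 : time c2 s <= weight c2 * E.
    by apply: leq_trans t2 _; apply: mono; rewrite leq_maxr.
  have t0 : esize e + 3 <= (esize e + 3) * E by rewrite leq_pmulr.
  by rewrite addnA mulnDl mulnDl; case: ifP => _; lia.
move=> mV lV nV ya zb.
have mV1 : {subset mod_vars c1 <= V} by move=> ? h; apply: mV; rewrite inE h orbT.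
have lV1 : {subset loop_vars c1 <= [:: y; z]} by move=> ? h; apply: lV; rewrite inE h orbT.
have nV1 v : v \in loop_vars c1 -> v \notin V by move=> h; apply: nV; rewrite inE h orbT.
have xV : x \in V by apply: mV; rewrite inE eqxx.
set E := a ^ nesting y c1 * b ^ nesting z c1.
have E0 : 0 < E by apply: pos.
have body s' : (forall v, v \in loop_vars c1 -> vr s' v = vr s v) ->
    time c1 s' <= weight c1 * E.
  move=> h; apply: IH1 => // hv; rewrite h //.
    by apply: ya; rewrite inE hv orbT.
  by apply: zb; rewrite inE hv orbT.
have stable s' v j : v \in loop_vars c1 -> vr (setv s' x j) v = vr s' v.
  move=> /nV1 h /=; rewrite eqn_eq ifF //; apply/negP => /eqP e.
  by rewrite e xV in h.
have bloop k s' : (forall v, v \in loop_vars c1 -> vr s' v = vr s v) ->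
    loop_time (run c1) (time c1) x k s' <= 3 + k * (5 + weight c1 * E).
  elim: k s' => [|k IHk] s' h //=.
  have h1 : time c1 (setv s' x k) <= weight c1 * E.
    by apply: body => v hv; rewrite stable // h.
  have h2 := IHk (run c1 (setv s' x k)).
  rewrite mulSn; have {}h2 := h2 _; suff: forall v, v \in loop_vars c1 ->
      vr (run c1 (setv s' x k)) v = vr s v by move=> /h2; lia.
  move=> v hv; rewrite run_var ?stable ?h //.
  by apply: contra (nV1 v hv) => /mV1.
have kb : vr s u <= a ^ (u == y) * b ^ (u == z).
  have /lV : u \in u :: loop_vars c1 by rewrite inE eqxx.
  rewrite !inE => /orP[/eqP e|/eqP e].
    by rewrite e eqxx (negPf nyz) expn1 muln1 ya // e inE eqxx.
  by rewrite e eqxx eq_sym (negPf nyz) expn1 mul1n zb // e inE eqxx.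
have := bloop (vr s u) (setv s x (vr s u)) (fun v hv => stable s v _ hv).
move=> t1; apply: (@leq_trans (5 + vr s u * (5 + weight c1 * E))); first by lia.
set F := a ^ (u == y) * b ^ (u == z) in kb.
have F0 : 0 < F by apply: pos.
have -> : a ^ ((u == y) + nesting y c1) * b ^ ((u == z) + nesting z c1) = F * E.
  by rewrite !expnD mulnACA.
have le1 : vr s u * (5 + weight c1 * E) <= F * (5 * E + weight c1 * E).
  by rewrite leq_mul // leq_add2r leq_pmulr.
have le2 : 5 <= 5 * (F * E) by rewrite leq_pmulr // muln_gt0 F0.
rewrite mulnDr in le1; nia.
Qed.

Section Simulation.

Variables (P : program) (W : nat).

Inductive runs : config -> config -> nat -> Prop :=
| Runs0 s : runs s s 0
| RunsS s I s' m : onth P (pc s) = Some I -> ~~ is_halt I ->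
    cost I s <= 2 * bitlen W -> runs (step I s) s' m -> runs s s' m.+1.

Lemma runs_trans s1 s2 s3 m1 m2 :
  runs s1 s2 m1 -> runs s2 s3 m2 -> runs s1 s3 (m1 + m2).
Proof.
move=> r12 r23; elim: r12 r23 => // s I s' m h1 h2 h3 _ IH /IH r.
by rewrite addSn; apply: RunsS r.
Qed.

Lemma runs_cast s q q' x w m m' :
  runs s (Config q x w) m -> q = q' -> m = m' -> runs s (Config q' x w) m'.
Proof. by move=> h <- <-. Qed.

Lemma runs_halts s s' m b : runs s s' m -> onth P (pc s') = Some (IHalt b) ->
  exists2 t, halts_from P s b t & t <= (m + 1) * (2 * bitlen W).
Proof.
elim=> [s0|s0 I s1 k h1 h2 h3 _ IH] hP.
  exists (cost (IHalt b) s0); first exact: HaltNow.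
  by case: s0 {hP} => p x w /=; rewrite /bitlen; lia.
have [t ht let_] := IH hP; exists (cost I s0 + t); first exact: HaltLater ht.
by rewrite addSn mulSn leq_add.
Qed.

Definition code_at (p : nat) (code : seq instr) : Prop :=
  forall i, i < size code -> onth P (p + i) = onth code i.

Lemma code_at_cat p c1 c2 :
  code_at p (c1 ++ c2) -> code_at p c1 /\ code_at (p + size c1) c2.
Proof.
move=> h; split=> i hi.
  by rewrite h ?onth_cat ?hi // size_cat; lia.
rewrite -addnA h ?size_cat; last lia.
by rewrite onth_cat ltnNge leq_addr /= addKn.
Qed.

Lemma code_at_head p I c : code_at p (I :: c) -> onth P p = Some I.
Proof. by move=> h; rewrite -[p]addn0 h. Qed.

Lemma code_at_tail p I c : code_at p (I :: c) -> code_at p.+1 c.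
Proof. by move=> h i hi; rewrite addSnnS h. Qed.

Definition below (x : nat -> nat) : Prop := forall r, x r <= W.

Lemma bitlen_le a b : a <= b -> bitlen a <= bitlen b.
Proof. by move=> h; rewrite /bitlen ltnS leq_trunc_log. Qed.

Lemma bitlen_cost a : a <= W -> bitlen a <= 2 * bitlen W.
Proof. by move=> /bitlen_le; lia. Qed.

Lemma bitlen_cost2 a b : a <= W -> b <= W -> bitlen a + bitlen b <= 2 * bitlen W.
Proof. by move=> /bitlen_le h1 /bitlen_le h2; lia. Qed.

Lemma step_const p x w r a : onth P p = Some (IConst r a) -> a <= W ->
  runs (Config p x w) (Config p.+1 (set_reg x r a) w) 1.
Proof.
move=> h ha; apply: (@RunsS (Config p x w) _ _ _ h _ _ (Runs0 _)) => //=.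
exact: bitlen_cost.
Qed.

Lemma step_add p x w r i j : onth P p = Some (IAdd r i j) -> below x ->
  runs (Config p x w) (Config p.+1 (set_reg x r (x i + x j)) w) 1.
Proof.
move=> h ha; apply: (@RunsS (Config p x w) _ _ _ h _ _ (Runs0 _)) => //=.
exact: bitlen_cost2.
Qed.

Lemma step_sub p x w r i j : onth P p = Some (ISub r i j) -> below x ->
  runs (Config p x w) (Config p.+1 (set_reg x r (x i - x j)) w) 1.
Proof.
move=> h ha; apply: (@RunsS (Config p x w) _ _ _ h _ _ (Runs0 _)) => //=.
exact: bitlen_cost2.
Qed.

Lemma step_load p x w r i : onth P p = Some (ILoad r i) -> below x ->
  runs (Config p x w) (Config p.+1 (set_reg x r (x (x i))) w) 1.
Proof.
move=> h ha; apply: (@RunsS (Config p x w) _ _ _ h _ _ (Runs0 _)) => //=.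
exact: bitlen_cost2.
Qed.

Lemma step_store p x w r i : onth P p = Some (IStore r i) -> below x ->
  runs (Config p x w) (Config p.+1 (set_reg x (x r) (x i)) w) 1.
Proof.
move=> h ha; apply: (@RunsS (Config p x w) _ _ _ h _ _ (Runs0 _)) => //=.
exact: bitlen_cost2.
Qed.

Lemma step_jump p x w r m : onth P p = Some (IJumpPos r m) -> below x ->
  runs (Config p x w) (Config (if 0 < x r then m else p.+1) x w) 1.
Proof.
move=> h ha; apply: (@RunsS (Config p x w) _ _ _ h _ _ (Runs0 _)) => //=.
exact: bitlen_cost.
Qed.

Lemma step_read p x w r : onth P p = Some (IRead r) -> head 0 w <= W ->
  runs (Config p x w) (Config p.+1 (set_reg x r (head 0 w)) (behead w)) 1.
Proof.
move=> h ha; apply: (@RunsS (Config p x w) _ _ _ h _ _ (Runs0 _)) => //=.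
exact: bitlen_cost.
Qed.

Lemma below_set x r a : below x -> a <= W -> below (set_reg x r a).
Proof. by move=> h ha j; rewrite /set_reg; case: eqP. Qed.

Definition sim (s : state) (x : nat -> nat) : Prop :=
  [/\ forall v, v < 31 -> x v = vr s v, x capreg = cp s &
      forall A i, A < 64 -> x (64 * i + (64 + A)) = ar s A i].

Definition keeps (d : nat) (x x' : nat -> nat) : Prop :=
  forall r, (r < scratch d) || (64 <= r) -> x' r = x r.

Lemma keeps_trans d x y z : keeps d x y -> keeps d y z -> keeps d x z.
Proof. by move=> h1 h2 r hr; rewrite h2 ?h1. Qed.

Lemma keepsS d x y : keeps d.+1 x y -> keeps d x y.
Proof. by move=> h r hr; apply: h; move: hr; rewrite /scratch; lia. Qed.

Lemma sim_keeps d s x x' : sim s x -> keeps d x x' -> sim s x'.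
Proof.
case=> h1 h2 h3 k; split=> [v hv|//|A i hA].
- by rewrite k ?h1 // /scratch; lia.
- by rewrite k.
- by rewrite k ?h3 //; lia.
Qed.

Lemma set_regE x r a j : set_reg x r a j = if j == r then a else x j.
Proof. by []. Qed.

Lemma keeps_set d d' x a : d <= d' -> d' < 32 -> keeps d x (set_reg x (scratch d') a).
Proof.
by move=> le1 le2 r; rewrite set_regE /scratch => hr; rewrite ifF //; lia.
Qed.

Lemma addr_code_ok A d p x w a : code_at p (addr_code A d) -> below x ->
  A < 64 -> d < 31 -> x (scratch d) = a -> 64 * a + 128 <= W ->
  exists2 x', runs (Config p x w) (Config (p + 8) x' w) 8 &
    [/\ x' (scratch d) = 64 * a + (64 + A), keeps d x x' & below x'].
Proof.
move=> hc bx hA hd xd hW.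
have dbl q y b : onth P q = Some (IAdd (scratch d) (scratch d) (scratch d)) ->
    below y -> y (scratch d) = b -> b + b <= W ->
    exists2 y', runs (Config q y w) (Config q.+1 y' w) 1 &
    [/\ y' (scratch d) = b + b, keeps d y y' & below y'].
  move=> h by_ yd hb; exists (set_reg y (scratch d) (b + b)).
    by have := step_add w h by_; rewrite yd.
  split; [by rewrite set_regE eqxx | apply: keeps_set => //; lia | exact: below_set].
have [y1 r1 [v1 k1 b1]] := dbl _ _ _ (code_at_head hc) bx xd ltac:(lia).
move: hc => /code_at_tail hc.
have [y2 r2 [v2 k2 b2]] := dbl _ _ _ (code_at_head hc) b1 v1 ltac:(lia).
move: hc => /code_at_tail hc.
have [y3 r3 [v3 k3 b3]] := dbl _ _ _ (code_at_head hc) b2 v2 ltac:(lia).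
move: hc => /code_at_tail hc.
have [y4 r4 [v4 k4 b4]] := dbl _ _ _ (code_at_head hc) b3 v3 ltac:(lia).
move: hc => /code_at_tail hc.
have [y5 r5 [v5 k5 b5]] := dbl _ _ _ (code_at_head hc) b4 v4 ltac:(lia).
move: hc => /code_at_tail hc.
have [y6 r6 [v6 k6 b6]] := dbl _ _ _ (code_at_head hc) b5 v5 ltac:(lia).
move: hc => /code_at_tail hc.
have r7 := step_const y6 w (code_at_head hc) ltac:(lia).
move: hc => /code_at_tail hc.
set y7 := set_reg _ _ _ in r7.
have b7 : below y7 by apply: below_set => //; lia.
have r8 := step_add w (code_at_head hc) b7.
set y8 := set_reg _ _ _ in r8.
have v8 : y8 (scratch d) = 64 * a + (64 + A).
  have nd : (scratch d == scratch d.+1) = false by rewrite /scratch; lia.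
  by rewrite /y8 /y7 !set_regE !eqxx nd v6; lia.
exists y8.
  have := runs_trans r1 (runs_trans r2 (runs_trans r3 (runs_trans r4
     (runs_trans r5 (runs_trans r6 (runs_trans r7 r8)))))).
  by have -> : p + 8 = p.+4.+4 by lia.
split=> //.
  apply: keeps_trans k1 _; apply: keeps_trans k2 _; apply: keeps_trans k3 _.
  apply: keeps_trans k4 _; apply: keeps_trans k5 _; apply: keeps_trans k6 _.
  by apply: keeps_trans (keeps_set _ _ _ _) (keeps_set _ _ _ _); lia.
apply: below_set => //; move: v8; rewrite {1}/y8 {1}/set_reg eqxx => ->; lia.
Qed.

Lemma wfe_depth e d : wfe e d -> d < 31.
Proof.
elim: e d => [b|x|e1 IH1 e2 IH2|e1 IH1 e2 IH2|A e IH] d //=.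
- by case/andP.
- by case/andP=> /IH1.
- by case/andP=> /IH1.
- by case/andP=> _ /IH.
Qed.

Lemma ecomp_ok e d p x w s : code_at p (ecomp e d) -> wfe e d ->
  sim s x -> bounded s -> below x -> 64 * cp s + 128 <= W ->
  exists2 x', runs (Config p x w) (Config (p + esize e) x' w) (esize e) &
    [/\ x' (scratch d) = eval s e, keeps d x x' & below x'].
Proof.
move=> + + + bs + hW.
elim: e d p x => [b|v|e1 IH1 e2 IH2|e1 IH1 e2 IH2|A e IH] d p x /= hc hwf ss bx.
- have hb : b <= W by case: b {hc}; lia.
  have r1 := step_const x w (code_at_head hc) hb.
  exists (set_reg x (scratch d) b); first by rewrite addn1.
  split; [by rewrite set_regE eqxx | apply: keeps_set => //; lia |].
  exact: below_set.
- have /andP[hv hd] := hwf.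
  have r1 := step_const x w (code_at_head hc) (leq0n _).
  have b1 := below_set (scratch d) bx (leq0n W).
  have r2 := step_add w (code_at_head (code_at_tail hc)) b1.
  have ev : set_reg x (scratch d) 0 v = vr s v.
    by case: ss => h _ _; rewrite set_regE ifF ?h // /scratch; lia.
  rewrite ev set_regE eqxx addn0 in r2.
  exists (set_reg (set_reg x (scratch d) 0) (scratch d) (vr s v)).
    by have := runs_trans r1 r2; have -> : p + 2 = p.+2 by lia.
  split; first by rewrite set_regE eqxx.
    by apply: keeps_trans (keeps_set _ _ _ _) (keeps_set _ _ _ _); lia.
  apply: below_set => //; case: bs => h _ _; have := h v; lia.
- have /andP[w1 w2] := hwf.
  have /code_at_cat[hc1 /code_at_cat[hc2 hc3]] := hc.
  rewrite ?size_addr_code !size_ecomp in hc2 hc3.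
  have [x1 r1 [v1 k1 b1]] := IH1 _ _ _ hc1 w1 ss bx.
  have [x2 r2 [v2 k2 b2]] := IH2 _ _ _ hc2 w2 (sim_keeps ss k1) b1.
  have v1' : x2 (scratch d) = eval s e1 by rewrite k2 // /scratch; lia.
  have c2 : x2 capreg = cp s.
    by have [_ -> _] := sim_keeps (sim_keeps ss k1) k2.
  have hd := wfe_depth w2.
  have l1 := bounded_eval e1 bs; have l2 := bounded_eval e2 bs.
  have nd : (scratch d == scratch d.+1) = false by rewrite /scratch; lia.
  have nd' : (scratch d.+1 == scratch d) = false by rewrite /scratch; lia.
  have nc : (capreg == scratch d) = false by rewrite /scratch /capreg; lia.
  have r3 := step_add w (code_at_head hc3) b2.
  rewrite v1' v2 in r3.
  set x3 := set_reg x2 _ _ in r3.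
  have b3 : below x3 by apply: below_set => //; lia.
  have r4 := step_sub w (code_at_head (code_at_tail hc3)) b3.
  have e3 : x3 (scratch d) = eval s e1 + eval s e2 by rewrite /x3 set_regE eqxx.
  have e3' : x3 capreg = cp s by rewrite /x3 set_regE nc.
  rewrite e3 e3' in r4.
  set x4 := set_reg x3 _ _ in r4.
  have b4 : below x4 by apply: below_set => //; lia.
  have r5 := step_sub w (code_at_head (code_at_tail (code_at_tail hc3))) b4.
  have e4 : x4 (scratch d) = eval s e1 + eval s e2 by rewrite /x4 set_regE nd.
  have e4' : x4 (scratch d.+1) = eval s e1 + eval s e2 - cp s.
    by rewrite /x4 set_regE eqxx.
  rewrite e4 e4' in r5.
  set x5 := set_reg x4 _ _ in r5.
  exists x5.
    by apply: runs_cast (runs_trans r1 (runs_trans r2 (runs_trans r3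
      (runs_trans r4 r5)))) _ _; lia.
  split; first by rewrite /x5 set_regE eqxx; lia.
    apply: keeps_trans k1 _; apply: keeps_trans (keepsS k2) _.
    have k3 : keeps d x2 x3 by apply: keeps_set; lia.
    have k4 : keeps d x3 x4 by apply: keeps_set; lia.
    have k5 : keeps d x4 x5 by apply: keeps_set; lia.
    exact: keeps_trans k3 (keeps_trans k4 k5).
  by apply: below_set => //; lia.
- have /andP[w1 w2] := hwf.
  have /code_at_cat[hc1 /code_at_cat[hc2 hc3]] := hc.
  rewrite ?size_addr_code !size_ecomp in hc2 hc3.
  have [x1 r1 [v1 k1 b1]] := IH1 _ _ _ hc1 w1 ss bx.
  have [x2 r2 [v2 k2 b2]] := IH2 _ _ _ hc2 w2 (sim_keeps ss k1) b1.
  have v1' : x2 (scratch d) = eval s e1 by rewrite k2 // /scratch; lia.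
  have hd := wfe_depth w2.
  have l1 := bounded_eval e1 bs.
  have r3 := step_sub w (code_at_head hc3) b2.
  rewrite v1' v2 in r3.
  exists (set_reg x2 (scratch d) (eval s e1 - eval s e2)).
    by apply: runs_cast (runs_trans r1 (runs_trans r2 r3)) _ _; lia.
  split; first by rewrite set_regE eqxx; lia.
    apply: keeps_trans k1 _; apply: keeps_trans (keepsS k2) _.
    by apply: keeps_set; lia.
  by apply: below_set => //; lia.
- have /andP[w1 w2] := hwf.
  have /code_at_cat[hc1 /(@code_at_cat _ (addr_code A d))[hc2 hc3]] := hc.
  rewrite ?size_addr_code !size_ecomp in hc2 hc3.
  have hd := wfe_depth w2.
  have [x1 r1 [v1 k1 b1]] := IH _ _ _ hc1 w2 ss bx.
  have l1 := bounded_eval e bs.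
  have [x2 r2 [v2 k2 b2]] := addr_code_ok w hc2 b1 w1 hd v1 ltac:(lia).
  have r3 := step_load w (code_at_head hc3) b2.
  have ea : x2 (x2 (scratch d)) = ar s A (eval s e).
    by have [_ _ h] := sim_keeps (sim_keeps ss k1) k2; rewrite v2 h.
  rewrite ea in r3.
  exists (set_reg x2 (scratch d) (ar s A (eval s e))).
    by apply: runs_cast (runs_trans r1 (runs_trans r2 r3)) _ _ => /=; lia.
  split; first by rewrite set_regE eqxx.
    apply: keeps_trans k1 _; apply: keeps_trans k2 _.
    by apply: keeps_set; lia.
  apply: below_set => //; case: bs => _ h _; have := h A (eval s e); lia.
Qed.

Lemma sim_setv s x v a : v < 31 -> sim s x -> sim (setv s v a) (set_reg x v a).
Proof.
move=> hv [h1 h2 h3]; split=> [u hu||A i hA] /=; rewrite set_regE.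
- by rewrite eqn_eq; case: eqP => // _; apply: h1.
- by rewrite ifF // /capreg; lia.
- by rewrite ifF ?h3 //; lia.
Qed.

Lemma comp_ok c p x s : code_at p (comp c p) -> wf c ->
  sim s x -> bounded s -> below x -> 64 * cp (run c s) + 128 <= W ->
  exists2 x', runs (Config p x (ip s))
                (Config (p + csize c) x' (ip (run c s))) (time c s) &
    sim (run c s) x' /\ below x'.
Proof.
elim: c p x s => [|v e|A e1 e2|v||c1 IH1 c2 IH2|e c1 IH1 c2 IH2|v y c1 IH1]
  p x s /= hc hwf ss bs bx hW.
- by exists x => //; rewrite addn0; apply: Runs0.
- have /andP[hv he] := hwf.
  have /code_at_cat[hc1 hc2] := hc; rewrite size_ecomp in hc2.
  have [x1 r1 [v1 k1 b1]] := ecomp_ok (ip s) hc1 he ss bs bx hW.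
  have l1 := bounded_eval e bs.
  have r2 := step_const x1 (ip s) (code_at_head hc2) (leq0n _).
  set x2 := set_reg x1 _ _ in r2.
  have b2 : below x2 by apply: below_set.
  have r3 := step_add (ip s) (code_at_head (code_at_tail hc2)) b2.
  have e3 : x2 (scratch 0) + x2 (scratch 1) = eval s e.
    by rewrite /x2 !set_regE /= v1 addn0.
  rewrite e3 in r3.
  exists (set_reg x2 v (eval s e)).
    by apply: runs_cast (runs_trans r1 (runs_trans r2 r3)) _ _; lia.
  split; last by apply: below_set => //; lia.
  apply: sim_setv => //; apply: (@sim_keeps 0) (sim_keeps ss k1) _.
  exact: keeps_set.
- have /and3P[hA he1 he2] := hwf.
  have /code_at_cat[hc1 /(@code_at_cat _ (addr_code A 0))[hc2
    /code_at_cat[hc3 hc4]]] := hc.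
  rewrite ?size_addr_code !size_ecomp in hc2 hc3 hc4.
  have l1 := bounded_eval e1 bs; have l2 := bounded_eval e2 bs.
  have [x1 r1 [v1 k1 b1]] := ecomp_ok (ip s) hc1 he1 ss bs bx hW.
  have ss1 := sim_keeps ss k1.
  have [x2 r2 [v2 k2 b2]] := addr_code_ok (ip s) hc2 b1 hA isT v1 ltac:(lia).
  have ss2 := sim_keeps ss1 k2.
  have [x3 r3 [v3 k3 b3]] := ecomp_ok (ip s) hc3 he2 ss2 bs b2 hW.
  have ss3 := sim_keeps ss2 k3.
  have r4 := step_store (ip s) (code_at_head hc4) b3.
  have e3 : x3 (scratch 0) = 64 * eval s e1 + (64 + A) by rewrite k3.
  rewrite e3 v3 in r4.
  set x4 := set_reg _ _ _ in r4; exists x4.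
    apply: runs_cast (runs_trans r1 (runs_trans r2 (runs_trans r3 r4))) _ _ => /=;
      lia.
  split; last by apply: below_set => //; lia.
  case: ss3 => h1 h2 h3; split=> [u hu||B i hB] /=; rewrite /x4 set_regE.
  + by rewrite ifF ?h1 //; lia.
  + by rewrite ifF ?h2 // /capreg; lia.
  + rewrite !eqn_eq h3 // (_ : (64 * i + (64 + B) == _) = (B == A) && (i == eval s e1)) //.
    by apply/eqP/andP => [h|[/eqP -> /eqP ->]] //; split; apply/eqP; lia.
- have r1 := step_read x (code_at_head hc) (_ : head 0 (ip s) <= W).
  have {}r1 := r1 ltac:(lia).
  set x1 := set_reg _ _ _ in r1.
  have b1 : below x1 by apply: below_set => //; lia.
  have r2 := step_add (behead (ip s)) (code_at_head (code_at_tail hc)) b1.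
  have [h1 h2 h3] := ss.
  have ev : x1 v = head 0 (ip s) by rewrite /x1 set_regE eqxx.
  have ec : x1 capreg = cp s by rewrite /x1 set_regE ifF // /capreg; lia.
  rewrite ev ec in r2; set x2 := set_reg _ _ _ in r2.
  exists x2; first by have := runs_trans r1 r2; have -> : p + 2 = p.+2 by lia.
  split; last by apply: below_set => //; lia.
  split=> [u hu||B i hB] /=; rewrite /x2 set_regE.
  + by rewrite ifF /x1 ?set_regE -?h1 ?eqn_eq // /capreg; lia.
  + by rewrite eqxx.
  + by rewrite !ifF /x1 ?set_regE ?ifF ?h3 // /capreg; lia.
- have r1 := step_add (ip s) (code_at_head hc) bx.
  have [h1 h2 h3] := ss; rewrite h2 in r1.
  exists (set_reg x capreg (cp s + cp s)); first by rewrite addn1.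
  split; last by apply: below_set => //; lia.
  split=> [u hu||B i hB] /=; rewrite set_regE.
  + by rewrite ifF ?h1 // /capreg; lia.
  + by rewrite eqxx.
  + by rewrite ifF ?h3 // /capreg; lia.
- have /andP[w1 w2] := hwf.
  have /code_at_cat[hc1 hc2] := hc; rewrite size_comp in hc2.
  have g2 := run_cp_ge c2 (run c1 s).
  have [x1 r1 [ss1 b1]] := IH1 _ _ _ hc1 w1 ss bs bx ltac:(lia).
  have [x2 r2 [ss2 b2]] := IH2 _ _ _ hc2 w2 ss1 (bounded_run c1 bs) b1 hW.
  by exists x2 => //; rewrite addnA; apply: runs_trans r1 r2.
- have /and3P[we w1 w2] := hwf.
  have /code_at_cat[hc1 /(@code_at_cat _ [:: _])[hc2
        /code_at_cat[hc3 /(@code_at_cat _ [:: _; _])[hc4 hc5]]]] := hc.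
  rewrite !size_comp !size_ecomp /= in hc2 hc3 hc4 hc5.
  have g : cp s <= cp (if 0 < eval s e then run c1 s else run c2 s).
    by case: ifP => _; apply: run_cp_ge.
  have [x1 r1 [v1 k1 b1]] := ecomp_ok (ip s) hc1 we ss bs bx ltac:(lia).
  have ss1 := sim_keeps ss k1.
  have r2 := step_jump (ip s) (code_at_head hc2) b1; rewrite v1 in r2.
  case: ifP hW r2 => he hW r2.
    have [x3 r3 [ss3 b3]] := IH1 _ _ _ hc5 w1 ss1 bs b1 hW.
    exists x3 => //.
    by apply: runs_cast (runs_trans r1 (runs_trans r2 r3)) _ _; lia.
  rewrite -addn1 in r2.
  have [x3 r3 [ss3 b3]] := IH2 _ _ _ hc3 w2 ss1 bs b1 hW.
  have r4 := step_const x3 (ip (run c2 s)) (code_at_head hc4) ltac:(lia).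
  set x4 := set_reg _ _ _ in r4.
  have b4 : below x4 by apply: below_set => //; lia.
  have r5 := step_jump (ip (run c2 s)) (code_at_head (code_at_tail hc4)) b4.
  rewrite (_ : x4 (scratch 0) = 1) /= in r5; last by rewrite /x4 set_regE eqxx.
  exists x4.
    by apply: runs_cast (runs_trans r1 (runs_trans r2 (runs_trans r3
      (runs_trans r4 r5)))) _ _; lia.
  by split=> //; apply: (@sim_keeps 0) ss3 _; apply: keeps_set.
- have /and4P[hv hy nv w1] := hwf.
  have /(@code_at_cat _ [:: _; _; _; _; _; _; _])[hc1 /code_at_cat[hc2 hc3]] := hc.
  rewrite size_comp /= in hc2 hc3.
  have at_ i : i < 7 -> onth P (p + i) = onth (take 7 (comp (CFor v y c1) p)) i.
    by move=> hi; rewrite hc1 //=; case: (comp c1 _).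
  have at0 := at_ 0 isT; have at1 := at_ 1 isT; have at2 := at_ 2 isT.
  have at3 := at_ 3 isT; have at4 := at_ 4 isT; have at5 := at_ 5 isT.
  have at6 := at_ 6 isT.
  rewrite /= in at0 at1 at2 at3 at4 at5 at6.
  have g : cp s <= cp (run (CFor v y c1) s) by apply: run_cp_ge.
  rewrite /= in g.
  rewrite addn0 in at0.
  have r0 := step_const x (ip s) at0 (leq0n _).
  set x0 := set_reg _ _ _ in r0.
  have b0 : below x0 by apply: below_set.
  rewrite -addn1 in r0.
  have r1 := step_add (ip s) at1 b0.
  have e1 : x0 y + x0 (scratch 0) = vr s y.
    have [h _ _] := ss.
    by rewrite /x0 !set_regE eqxx ifF ?h ?addn0 // /scratch; lia.
  rewrite e1 in r1.
  have bv : vr s y <= cp s by case: bs.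
  set x1 := set_reg _ _ _ in r1.
  have b1 : below x1 by apply: below_set => //; lia.
  have ss1 : sim (setv s v (vr s y)) x1.
    by apply: sim_setv => //; apply: (@sim_keeps 0) ss _; apply: keeps_set.
  have bs1 : bounded (setv s v (vr s y)) by apply: bounded_setv.
  have sv1 : vr (setv s v (vr s y)) v = vr s y by rewrite /= eqn_eq eqxx.
  have {r0 e1} r1 := runs_trans r0 r1.
  clearbody x1; clear x0 b0 g bv.
  set s1 := setv s v (vr s y) in hW ss1 bs1 sv1 r1 *.
  rewrite -[ip s]/(ip s1) in r1 *.
  move: (vr s y) sv1 hW r1 => k sv1 hW r1; clearbody s1; clear bs ss s.
  rewrite (_ : (p + 1).+1 = p + 2) in r1; last lia.
  suff [x' r' hx'] : exists2 x',
      runs (Config (p + 2) x1 (ip s1))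
           (Config (p + (7 + (csize c1 + 2))) x' (ip (loop (run c1) v k s1)))
           (loop_time (run c1) (time c1) v k s1) &
      sim (loop (run c1) v k s1) x' /\ below x'.
    by exists x' => //; apply: runs_trans r1 r'.
  elim: k s1 x1 sv1 bs1 ss1 b1 hW {r1} => [|k IHk] s1 x1 sv1 bs1 ss1 b1 /= hW.
    have r2 := step_jump (ip s1) at2 b1.
    have [hx _ _] := ss1; rewrite hx // sv1 /= (_ : (p + 2).+1 = p + 3) in r2; last lia.
    have r3 := step_const x1 (ip s1) at3 ltac:(lia).
    set x3 := set_reg _ _ _ in r3.
    have b3 : below x3 by apply: below_set => //; lia.
    rewrite (_ : (p + 3).+1 = p + 4) in r3; last lia.
    have r4 := step_jump (ip s1) at4 b3.
    rewrite (_ : x3 (scratch 0) = 1) /= in r4; last by rewrite /x3 set_regE eqxx.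
    exists x3.
      by apply: runs_cast (runs_trans r2 (runs_trans r3 r4)) _ _; lia.
    by split=> //; apply: (@sim_keeps 0) ss1 _; apply: keeps_set.
  have r2 := step_jump (ip s1) at2 b1.
  have [hx _ _] := ss1; rewrite hx // sv1 /= in r2.
  have r3 := step_const x1 (ip s1) at5 ltac:(lia).
  set x3 := set_reg _ _ _ in r3.
  have b3 : below x3 by apply: below_set => //; lia.
  rewrite (_ : (p + 5).+1 = p + 6) in r3; last lia.
  have r4 := step_sub (ip s1) at6 b3.
  have e4 : x3 v - x3 (scratch 0) = k.
    by rewrite /x3 !set_regE eqxx ifF ?hx ?sv1 ?subn1 // /scratch; lia.
  rewrite e4 (_ : (p + 6).+1 = p + 7) in r4; last lia.
  have kcp : k <= cp s1 by case: bs1 => h _ _; have := h v; rewrite sv1; lia.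
  have gl : cp (run c1 (setv s1 v k)) <= cp (loop (run c1) v k (run c1 (setv s1 v k))).
    apply: (@loop_ind _ _ _ (fun _ s' => cp (run c1 (setv s1 v k)) <= cp s')) => //.
    by move=> j s' _ h; apply: leq_trans h _; apply: (leq_trans _ (run_cp_ge _ _)).
  have g1 := run_cp_ge c1 (setv s1 v k); rewrite /= in g1.
  set x4 := set_reg _ _ _ in r4.
  have b4 : below x4 by apply: below_set => //; lia.
  have ss4 : sim (setv s1 v k) x4.
    by apply: sim_setv => //; apply: (@sim_keeps 0) ss1 _; apply: keeps_set.
  have bs4 : bounded (setv s1 v k) by apply: bounded_setv.
  have [x5 r5 [ss5 b5]] := IH1 _ _ _ hc2 w1 ss4 bs4 b4 ltac:(lia).
  have r6 := step_const x5 (ip (run c1 (setv s1 v k))) (code_at_head hc3) ltac:(lia).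
  set x6 := set_reg _ _ _ in r6.
  have b6 : below x6 by apply: below_set => //; lia.
  have r7 := step_jump (ip (run c1 (setv s1 v k))) (code_at_head (code_at_tail hc3)) b6.
  rewrite (_ : x6 (scratch 0) = 1) /= in r7; last by rewrite /x6 set_regE eqxx.
  have ss6 : sim (run c1 (setv s1 v k)) x6.
    by apply: (@sim_keeps 0) ss5 _; apply: keeps_set.
  have sv6 : vr (run c1 (setv s1 v k)) v = k.
    by rewrite run_var //= eqn_eq eqxx.
  have [x' r' hx'] := IHk _ _ sv6 (bounded_run c1 bs4) ss6 b6 hW.
  exists x' => //.
  apply: runs_cast (runs_trans r2 (runs_trans r3 (runs_trans r4 (runs_trans r5
    (runs_trans r6 (runs_trans r7 r')))))) _ _; lia.
Qed.

End Simulation.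

Definition program_of (c : com) (res : nat) : program :=
  IConst capreg 1 :: comp c 1 ++
  [:: IJumpPos res (csize c + 3); IHalt false; IHalt true].

Definition start (w : seq nat) : state := State (fun=> 0) (fun _ _ => 0) 1 w.

Lemma program_of_halts c res w : wf c -> res < 31 ->
  let s := run c (start w) in
  exists2 t, halts_on (program_of c res) w (0 < vr s res) t &
    t <= (time c (start w) + 3) * (2 * bitlen (64 * cp s + 128)).
Proof.
move=> hwf hres s; set P := program_of c res; set W := 64 * cp s + 128.
have cP : code_at P 0 P by [].
have /(@code_at_cat _ _ [:: _])[hc0 /code_at_cat[hc1 hc2]] : code_at P 0 P := cP.
rewrite size_comp add0n /= in hc1 hc2.
have r0 := step_const (W := W) (fun=> 0) w (code_at_head hc0) ltac:(lia).
set x0 := set_reg _ _ _ in r0.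
have b0 : below W x0 by apply: below_set => //; lia.
have ss0 : sim (start w) x0.
  split=> [v hv||A i hA] //=; rewrite /x0 set_regE ?ifF // /capreg; lia.
have bs0 : bounded (start w) by split.
have [x1 r1 [ss1 b1]] := comp_ok hc1 hwf ss0 bs0 b0 (leqnn _).
have r2 := step_jump (ip s) (code_at_head hc2) b1.
have [hx _ _] := ss1; rewrite hx // in r2.
have r := runs_trans r0 (runs_trans r1 r2).
have [|t ht let_] := runs_halts r (b := 0 < vr s res).
  case: ifP => hr /=.
    by have := hc2 2 isT; rewrite (_ : 1 + _ + _ = csize c + 3) //; lia.
  by have := hc2 1 isT; rewrite addn1.
by exists t => //; apply: leq_trans let_ _; rewrite leq_mul2r; apply/orP; right; lia.
Qed.

(** * The program *)

(* Variables: [vnn] is n^2, [vk] and [vq] the sizes of M and of its complement,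
   [vtrk] tells whether all vertices are tracked, [vb] is the number of classes
   still allowed inside M, [vN] the number of triples (X, D, S), [vj] the current
   vertex, [ve] an index into the adjacency matrix [aG], [vp] an index into the
   table [aT], [vne] tells whether S is nonempty, and [vc] is the carry of the
   odometer.  The array [aK] holds the tracked vertices. *)
Notation vn := 0 (only parsing).
Notation vl := 1 (only parsing).
Notation ve := 2 (only parsing).
Notation vx := 3 (only parsing).
Notation vnn := 4 (only parsing).
Notation vk := 5 (only parsing).
Notation vq := 6 (only parsing).
Notation vtrk := 7 (only parsing).
Notation vb := 8 (only parsing).
Notation vN := 9 (only parsing).
Notation vj := 10 (only parsing).
Notation vit := 11 (only parsing).
Notation vu := 12 (only parsing).
Notation vv := 13 (only parsing).
Notation vp := 14 (only parsing).
Notation vok := 15 (only parsing).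
Notation vne := 16 (only parsing).
Notation vd := 17 (only parsing).
Notation vc := 18 (only parsing).
Notation vres := 19 (only parsing).

Notation aG := 0 (only parsing).
Notation aM := 1 (only parsing).
Notation aA := 2 (only parsing).
Notation aX := 3 (only parsing).
Notation aD := 4 (only parsing).
Notation aS := 5 (only parsing).
Notation aT := 6 (only parsing).
Notation aK := 7 (only parsing).

Definition ENot (e : expr) := ESub (EBit true) e.
Definition EOr (e1 e2 : expr) := ENot (ESub (ENot e1) e2).
Definition EInc (x : nat) := EAdd (EVar x) (EBit true).
Definition EDbl (x : nat) := EAdd (EVar x) (EVar x).
Definition EAt (B x : nat) := EGet B (EVar x).

Lemma eval_not s e : eval s (ENot e) = (eval s e == 0).
Proof. by rewrite /=; case: (eval s e). Qed.

Lemma eval_or s e1 e2 :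
  eval s (EOr e1 e2) = (0 < eval s e1) || (0 < eval s e2).
Proof. by rewrite /=; case: (eval s e1) => [|a]; case: (eval s e2). Qed.

Infix ";;" := CSeq (at level 61, right associativity).

Lemma run_seq c1 c2 s : run (c1 ;; c2) s = run c2 (run c1 s).
Proof. by []. Qed.

Lemma run_seq4 c1 c2 c3 c4 s :
  run (c1 ;; c2 ;; c3 ;; c4) s = run c4 (run c3 (run c2 (run c1 s))).
Proof. by []. Qed.

Lemma time_seq4 c1 c2 c3 c4 s (s1 := run c1 s) (s2 := run c2 s1) :
  time (c1 ;; c2 ;; c3 ;; c4) s =
  time c1 s + (time c2 s1 + (time c3 s2 + time c4 (run c3 s2))).
Proof. by []. Qed.

Definition c_grow := CFor vv vn (CGrow ;; CGrow ;; CGrow).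

Definition c_fill (B : nat) :=
  CFor vv vn
    (CRead vx ;; CPut B (EVar ve) (EVar vx) ;; CSet ve (EInc ve)).

Definition c_graph :=
  CSet ve (EBit false) ;; CFor vu vn (c_fill aG) ;; CSet vnn (EVar ve).

Definition c_modulator := CSet ve (EBit false) ;; c_fill aM.

Definition c_count :=
  CSet vk (EBit false) ;; CSet vq (EBit false) ;;
  CFor vv vn
    (CIf (EAt aM vv) (CSet vk (EInc vk)) (CSet vq (EInc vq))) ;;
  CSet vtrk (ENot (ESub (EVar vq) (EVar vk))) ;;
  CSet vb (ESub (EVar vl) (EVar vq)).

Definition c_flags :=
  CFor vv vn
    (CPut aK (EVar vv) (EOr (EAt aM vv) (EVar vtrk)) ;;
     CPut aD (EVar vv) (ENot (EAt aK vv))).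

Definition c_budget :=
  CFor vv vn
    (CIf (EAt aM vv)
      (CIf (EVar vb)
        (CPut aA (EVar vv) (EBit true) ;;
         CSet vb (ESub (EVar vb) (EBit true)))
        CSkip)
      CSkip).

Definition c_size :=
  CSet vN (EBit true) ;;
  CFor vv vn
    (CIf (EAt aM vv) (CSet vN (EDbl vN) ;; CSet vN (EDbl vN)) CSkip ;;
     CIf (EAt aK vv) (CSet vN (EDbl vN)) CSkip).

Definition c_enc (e : expr) :=
  CFor vv vn (CSet vp (EDbl vp) ;; CSet vp (EAdd (EVar vp) e)).

Definition c_start :=
  CSet vp (EVar vn) ;; c_enc (EAt aX vv) ;; c_enc (EAt aD vv) ;;
  CPut aT (EVar vp) (EBit true).

Definition c_incr (B F : nat) :=
  CFor vv vn
    (CIf (EAt F vv)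
      (CIf (EVar vc)
        (CIf (EAt B vv)
          (CPut B (EVar vv) (EBit false))
          (CPut B (EVar vv) (EBit true) ;; CSet vc (EBit false)))
        CSkip)
      CSkip).

(* The odometer has the bits of X and S in M and the tracked bits of D; it wraps
   around, so it may be started anywhere. *)
Definition c_next :=
  CSet vc (EBit true) ;; c_incr aX aM ;; c_incr aD aK ;; c_incr aS aM.

Definition c_lookup :=
  CSet vp (EInc vj) ;; c_enc (EAt aX vv) ;; c_enc (EAt aD vv) ;;
  CSet vok (EAt aT vp).

Definition c_disjoint :=
  CSet vne (EBit false) ;;
  CFor vv vn
    (CIf (EAt aS vv)
      (CSet vne (EBit true) ;;
       CIf (EAt aX vv) (CSet vok (EBit false)) CSkip)
      CSkip).

Definition c_allowed :=
  CIf (EVar vne)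
    (CIf (EAt aM vj) (CIf (EAt aA vj) CSkip (CSet vok (EBit false))) CSkip)
    CSkip.

Definition c_row :=
  CFor vv vn
    (CSet ve (ESub (EVar ve) (EBit true)) ;;
     CIf (EAt aS vv)
       (CIf (EAt aG ve)
         (CIf (EAt aS vu) (CSet vok (EBit false)) CSkip)
         (CIf (EOr (ESub (EVar vu) (EVar vv)) (ESub (EVar vv) (EVar vu)))
           (CSet vd (EBit false)) CSkip))
       CSkip).

Definition c_neighbors :=
  CSet ve (EVar vnn) ;;
  CFor vu vn
    (CSet vd (EVar vne) ;; c_row ;;
     CSet vp (EDbl vp) ;; CSet vp (EAdd (EVar vp) (EOr (EAt aD vu) (EVar vd)))).

Definition c_try :=
  c_lookup ;; c_disjoint ;; c_allowed ;;
  CSet vp (EVar vj) ;; c_enc (EOr (EAt aX vv) (EAt aS vv)) ;;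
  c_neighbors ;;
  CIf (EVar vok) (CPut aT (EVar vp) (EBit true)) CSkip.

Definition c_slot :=
  CPut aS (EVar vj) (ENot (EAt aM vj)) ;;
  CFor vit vN (c_try ;; c_next) ;;
  CPut aX (EVar vj) (EOr (EAt aX vj) (ENot (EAt aM vj))) ;;
  CPut aS (EVar vj) (EBit false).

Definition c_answer :=
  CSet vp (EBit false) ;; c_enc (EBit true) ;; c_enc (EBit true) ;;
  CSet vres (EAt aT vp) ;;
  CIf (ESub (EVar vq) (EVar vl)) (CSet vres (EBit false)) CSkip.

Definition c_input := c_grow ;; CRead vl ;; c_graph ;; c_modulator.
Definition c_prepare := c_count ;; c_flags ;; c_budget ;; c_size ;; c_start.
Definition c_main := CFor vj vn c_slot ;; c_answer.
Definition c_all := CRead vn ;; c_input ;; c_prepare ;; c_main.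

(* Appends the bits of [f], from [k - 1] down to 0, to the binary expansion of [p]. *)
Fixpoint enc (p : nat) (f : nat -> bool) (k : nat) : nat :=
  if k is k'.+1 then enc (p + p + f k') f k' else p.

Lemma enc_inj p p' f f' k : enc p f k = enc p' f' k ->
  p = p' /\ forall i, i < k -> f i = f' i.
Proof.
elim: k p p' => [|k IHk] p p' //= /IHk[e h].
have ef : f k = f' k by move: e; case: (f k); case: (f' k); lia.
split; first by rewrite ef in e; lia.
by move=> i; rewrite ltnS leq_eqVlt => /orP[/eqP->|/h].
Qed.

Lemma enc_lt p f k : enc p f k < p.+1 * 2 ^ k.
Proof.
elim: k p => [|k IHk] p /=; first by rewrite muln1.
apply: leq_trans (IHk _) _; rewrite expnS mulnA leq_mul2r; apply/orP; right.
by case: (f k); lia.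
Qed.

Section Programs.

Variable n : nat.

Definition bit (X : {set 'I_n}) (i : nat) : bool :=
  if insub i is Some v then v \in X else false.

Lemma bitE X (v : 'I_n) : bit X v = (v \in X).
Proof. by rewrite /bit valK. Qed.

Definition rep (s : state) (B : nat) (X : {set 'I_n}) : Prop :=
  forall v : 'I_n, ar s B v = (v \in X).

Lemma rep_lt s B X j : rep s B X -> j < n -> ar s B j = bit X j.
Proof. by move=> h ltj; rewrite (h (Ordinal ltj)) -bitE. Qed.

Lemma rep_out V W s s' B X : same_outside V W s s' -> B \notin W ->
  rep s B X -> rep s' B X.
Proof. by case=> _ sa _ hB h v; rewrite sa. Qed.

Lemma rep_run c s B X : B \notin mod_arrays c -> rep s B X -> rep (run c s) B X.
Proof. by move=> hB h v; rewrite run_arr. Qed.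

Lemma enc_ok e (f : nat -> bool) s : vr s vn = n -> (vr s vp).+1 * 2 ^ n <= cp s ->
  (forall j s', j < n -> vr s' vv = j -> same_outside [:: vv; vp] [::] s s' ->
     eval s' e = f j) ->
  vr (run (c_enc e) s) vp = enc (vr s vp) f n.
Proof.
move=> en hcap he.
pose I j s' := same_outside [:: vv; vp] [::] s s' /\
  [/\ enc (vr s' vp) f j = enc (vr s vp) f n & (vr s' vp).+1 * 2 ^ j <= cp s].
suff [_ [<-]] : I 0 (run (c_enc e) s) by [].
apply: run_for => [|j s'].
  rewrite en; split=> //; split=> // y; rewrite !inE negb_or /= => /andP[/negPf h _].
  by rewrite eqn_eq h.
rewrite en => ltj _ [so [e1 e2]].
have [sv sa sc] := so.
set p := vr s' vp in e1 e2.
rewrite expnS mulnCA in e2.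
have pos : 0 < 2 ^ j by rewrite expn_gt0.
have dbl : minn (p + p) (cp s') = p + p by nia.
set s1 := run (CSet vp (EDbl vp)) (setv s' vv j).
have so1 : same_outside [:: vv; vp] [::] s s1.
  split=> // y hy; rewrite -(sv y hy) /s1 /=.
  by move: hy; rewrite !inE negb_or !eqn_eq => /andP[/negPf-> /negPf->].
have ee : eval s1 e = f j by apply: he.
have hs : minn (p + p + f j) (cp s') = p + p + f j by case: (f j); nia.
have E1 : vr s1 vp = p + p by rewrite /s1 /= dbl.
have E : run (CSet vp (EDbl vp);; CSet vp (EAdd (EVar vp) e)) (setv s' vv j) =
         setv s1 vp (minn (vr s1 vp + eval s1 e) (cp s')) by [].
rewrite E E1 ee hs {E}; clearbody s1; split.
  have [sv1 sa1 sc1] := so1; split=> // y hy; rewrite /= sv1 //.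
  by move: hy; rewrite !inE negb_or eqn_eq => /andP[_ /negPf->].
split=> //=.
by case: (f j); nia.
Qed.

End Programs.

(** * One transition *)

Section Transition.

Variables (n : nat) (G : sgraph 'I_n) (M A : {set 'I_n}).

Definition code (j : nat) (X D : {set 'I_n}) : nat :=
  enc (enc j (bit X) n) (bit D) n.

Lemma eq_bit (X Y : {set 'I_n}) : (forall i, i < n -> bit X i = bit Y i) -> X = Y.
Proof.
by move=> h; apply/setP => v; rewrite -!bitE h.
Qed.

Lemma code_inj j j' X X' D D' : code j X D = code j' X' D' ->
  [/\ j = j', X = X' & D = D'].
Proof. by case/enc_inj => /enc_inj[-> /eq_bit->] /eq_bit->. Qed.

Record env (s : state) : Prop := Env {
  env_n : vr s vn = n;
  env_nn : vr s vnn = n * n;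
  env_G : forall u v : 'I_n, ar s aG (u * n + v) = G u v;
  env_M : rep s aM M;
  env_A : rep s aA A;
  env_K : rep s aK (tracked M);
  env_cp : n.+1 * 8 ^ n <= cp s
}.

Definition env_safe (V W : seq nat) : bool :=
  [&& vn \notin V, vnn \notin V, aG \notin W, aM \notin W, aA \notin W & aK \notin W].

Lemma env_out V W s s' : same_outside V W s s' -> env_safe V W ->
  env s -> env s'.
Proof.
move=> so /and5P[h1 h2 h3 h4 /andP[h5 h6]] [e1 e2 e3 e4 e5 e6 e7].
have [sv sa sc] := so; split; rewrite ?sv //.
- by move=> u v; rewrite sa.
- exact: rep_out so _ e4.
- exact: rep_out so _ e5.
- exact: rep_out so _ e6.
- exact: leq_trans e7 sc.
Qed.

Lemma env_run c s : env_safe (mod_vars c) (mod_arrays c) -> env s -> env (run c s).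
Proof. exact/env_out/same_outside_run. Qed.

Lemma same_outside_setv x a s : same_outside [:: x] [::] s (setv s x a).
Proof. by split=> // y; rewrite inE /= eqn_eq => /negPf->. Qed.

Lemma env_setv x a s : env_safe [:: x] [::] -> env s -> env (setv s x a).
Proof. exact/env_out/same_outside_setv. Qed.

Lemma cap_enc s p : env s -> p <= n -> p.+1 * 2 ^ n * 2 ^ n <= cp s.
Proof.
case=> _ _ _ _ _ _ h lep; apply: leq_trans h.
rewrite -mulnA -expnMn leq_mul //.
by case: (n) => // m; rewrite leq_exp2r.
Qed.

Lemma cap_enc1 s p : env s -> p <= n -> p.+1 * 2 ^ n <= cp s.
Proof.
move=> e /(cap_enc e); apply: leq_trans; rewrite leq_pmulr // expn_gt0 //.
Qed.

Lemma enc_at s B (X : {set 'I_n}) : vr s vn = n -> rep s B X ->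
  (vr s vp).+1 * 2 ^ n <= cp s ->
  vr (run (c_enc (EAt B vv)) s) vp = enc (vr s vp) (bit X) n.
Proof.
move=> en hB hc; apply: enc_ok => // j s' ltj ej [_ sa _] /=.
by rewrite ej sa // (rep_lt hB).
Qed.

Lemma enc_pair s p X D B C : env s -> vr s vp = p -> p <= n ->
  rep s B X -> rep s C D ->
  vr (run (c_enc (EAt C vv)) (run (c_enc (EAt B vv)) s)) vp = code p X D.
Proof.
move=> es ep lep hX hD.
have e1 : vr (run (c_enc (EAt B vv)) s) vp = enc p (bit X) n.
  by rewrite (@enc_at s B X) ?ep ?env_n // cap_enc1.
rewrite (@enc_at _ C D) ?e1 //.
- by rewrite run_var // env_n.
- exact: rep_run.
- apply: leq_trans (run_cp_ge _ _).
  apply: leq_trans (cap_enc es lep); rewrite leq_mul2r; apply/orP; right.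
  exact: enc_lt.
Qed.

Definition upto (j : nat) (P : pred 'I_n) : bool :=
  [forall v : 'I_n, (j <= v) ==> P v].

Lemma upto_n P : upto n P.
Proof. by apply/forallP => v; rewrite leqNgt ltn_ord. Qed.

Lemma upto_step P (v : 'I_n) : upto v P = P v && upto v.+1 P.
Proof.
apply/forallP/andP => [h|[Pv /forallP h] u].
  split; first by have := h v; rewrite leqnn.
  by apply/forallP => u; apply/implyP => lt; have := h u; rewrite ltnW.
case: (leqP v u) => //=; rewrite leq_eqVlt => /orP[/eqP/val_inj<- //|lt].
by have := h u; rewrite lt.
Qed.

Lemma upto_0 P : upto 0 P = [forall v, P v].
Proof. by apply: eq_forallb => v. Qed.

Lemma c_lookup_ok s j X D : env s -> rep s aX X -> rep s aD D ->
  vr s vj = j -> j < n -> vr (run c_lookup s) vok = ar s aT (code j.+1 X D).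
Proof.
move=> es hX hD ej ltj; rewrite /c_lookup.
set s1 := run (CSet vp (EInc vj)) s.
have c1 := cap_enc1 es ltj.
have pos : 0 < 2 ^ n by rewrite expn_gt0.
have e1 : vr s1 vp = j.+1 by rewrite /s1 /= ej; nia.
have es1 : env s1 by apply: env_run.
have := enc_pair es1 e1 ltj (hX : rep s1 aX X) (hD : rep s1 aD D).
set s2 := run _ (run _ s1) => e2.
rewrite -[vr _ _]/(ar s2 aT (vr s2 vp)) e2 /s2.
by rewrite !run_arr.
Qed.

Lemma c_disjoint_ok s (X S : {set 'I_n}) : env s -> rep s aX X -> rep s aS S ->
  let s' := run c_disjoint s in
  vr s' vne = (S != set0) /\
  (0 < vr s' vok) = (0 < vr s vok) && [disjoint S & X].
Proof.
move=> es hX hS s'; rewrite {}/s' /c_disjoint.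
set s1 := run (CSet vne (EBit false)) s.
pose I j s' := vr s' vne = ~~ upto j (fun v => v \notin S) /\
  (0 < vr s' vok) = (0 < vr s vok) && upto j (fun v => ~~ ((v \in S) && (v \in X))).
set c := CFor _ _ _; suff [h1 h2] : I 0 (run c s1).
  rewrite -[run _ s]/(run c s1) h1 h2 !upto_0; split.
    congr nat_of_bool; rewrite -negb_exists negbK; apply/existsP/set0Pn.
      by case=> v; exists v.
    by case=> v; exists v.
  congr andb; rewrite disjoint_subset; apply/forallP/subsetP => h v.
    by move=> vS; have := h v; rewrite vS.
  by apply/negP => /andP[/h]; rewrite inE => /negPf->.
have en1 : vr s1 vn = n by rewrite -(env_n es).
apply: run_for => [|j s2]; first by rewrite en1 /I !upto_n /= andbT.
rewrite en1 => ltj [_ sa _] [i1 i2].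
pose v := Ordinal ltj; rewrite -[j]/(nat_of_ord v) in i1 i2 *.
have eS : ar s2 aS v = (v \in S) by rewrite sa // -hS.
have eX : ar s2 aX v = (v \in X) by rewrite sa // -hX.
rewrite /I !upto_step /= eS eX lt0b.
case: (v \in S) => //=; rewrite lt0b; case: (v \in X) => //=.
by rewrite andbF.
Qed.

Lemma c_allowed_ok s (j : 'I_n) (b : bool) : env s -> vr s vj = j -> vr s vne = b ->
  (0 < vr (run c_allowed s) vok) =
  (0 < vr s vok) && (b ==> ((j \notin M) || (j \in A))).
Proof.
move=> es ej eb; rewrite /c_allowed /= eb lt0b ej (env_M es) (env_A es).
by case: b eb => /= _; case: (j \in M); case: (j \in A); rewrite /= ?andbT ?andbF.
Qed.

Lemma c_row_ok s (u : 'I_n) (S : {set 'I_n}) (d : bool) : env s -> rep s aS S ->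
  vr s vu = u -> vr s ve = u * n + n -> vr s vd = d ->
  let s' := run c_row s in
  [/\ vr s' ve = u * n,
      vr s' vd = d && [forall v, (v \in S) ==> G u v || (v == u)] &
      (0 < vr s' vok) = (0 < vr s vok) &&
        [forall v, (u \in S) && (v \in S) ==> ~~ G u v]].
Proof.
move=> es hS eu ee ed s'; rewrite {}/s'.
pose I j s' := [/\ vr s' ve = u * n + j,
      vr s' vd = d && upto j (fun v => (v \in S) ==> G u v || (v == u)) &
      (0 < vr s' vok) = (0 < vr s vok) &&
        upto j (fun v => (u \in S) && (v \in S) ==> ~~ G u v)].
suff : I 0 (run c_row s) by rewrite /I !upto_0 addn0.
apply: run_for => [|j s2]; first by rewrite (env_n es) /I !upto_n !andbT.
rewrite (env_n es) => ltj [sv sa _] [i0 i1 i2].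
pose v := Ordinal ltj; rewrite -[j]/(nat_of_ord v) in i0 i1 i2 *.
have eS w : ar s2 aS (nat_of_ord w) = (w \in S) by rewrite sa // -hS.
have eG : ar s2 aG (u * n + v) = G u v by rewrite sa // -(env_G es).
have eu2 : vr s2 vu = u by rewrite sv.
have e1 : u * n + v.+1 - 1 = u * n + v by lia.
rewrite /I !upto_step /= i0 e1 (eS v) eG eu2 (eS u) !lt0b.
case: (v \in S) => /=; last by rewrite andbF.
rewrite andbT; case: (G u v) => /=.
  by move: i2; case: (u \in S) => /= i2; split; rewrite ?andbF.
rewrite implybT /= -val_eqE /=.
have -> : (0 < 1 - (1 - (u - j) - (j - u))) = (j != u) by lia.
by case: eqP => /= _; split; rewrite ?andbF.
Qed.

Lemma c_neighbors_ok s p (S D : {set 'I_n}) : env s -> rep s aS S -> rep s aD D ->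
  vr s vne = (S != set0) -> vr s vp = p -> p.+1 * 2 ^ n <= cp s ->
  let s' := run c_neighbors s in
  vr s' vp = enc p (bit (D :|: dominators G S)) n /\
  (0 < vr s' vok) = (0 < vr s vok) && independent G S.
Proof.
move=> es hS hD ene ep hc s'; rewrite {}/s' /c_neighbors.
set s1 := run (CSet ve (EVar vnn)) s.
set f := bit (D :|: dominators G S).
pose I j s' := [/\ vr s' ve = j * n, enc (vr s' vp) f j = enc p f n,
   (vr s' vp).+1 * 2 ^ j <= cp s &
   (0 < vr s' vok) = (0 < vr s vok) &&
     upto j (fun u => [forall v, (u \in S) && (v \in S) ==> ~~ G u v])].
set c := CFor _ _ _; suff [_ h1 _ h2] : I 0 (run c s1).
  by rewrite -[run _ s]/(run c s1) h2 !upto_0.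
have en1 : vr s1 vn = n by rewrite -(env_n es).
apply: run_for => [|j s2].
  by rewrite en1 /I !upto_n andbT /= (env_nn es) ep; split.
rewrite en1 => ltj so [i0 i1 i2 i3].
pose u := Ordinal ltj; have [sv sa sc] := so.
set s3 := run (CSet vd (EVar vne)) (setv s2 vu j).
have es2 : env s2 by apply: env_out so _ (env_run (c := CSet ve (EVar vnn)) _ es).
have es3 : env s3 by apply/env_run => //; apply: env_setv.
have hS3 : rep s3 aS S by move=> w; rewrite -hS -[ar s3 _ _]/(ar s2 aS w) sa.
have u3 : vr s3 vu = u by [].
have e3 : vr s3 ve = u * n + n by rewrite -[vr _ _]/(vr s2 ve) i0 mulSn addnC.
have d3 : vr s3 vd = (S != set0) by rewrite -ene -[vr s3 _]/(vr s2 vne) sv.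
have [r1 r2 r3] := c_row_ok es3 hS3 u3 e3 d3.
set s4 := run c_row s3 in r1 r2 r3.
set q := vr s2 vp in i1 i2.
have q4 : vr s4 vp = q by rewrite /s4 run_var.
have c4 : cp s <= cp s4.
  by apply: leq_trans (run_cp_ge _ _); apply: leq_trans sc _.
have D4 : ar s4 aD u = (u \in D) by rewrite -hD /s4 run_arr // -[ar s3 _ _]/(ar s2 aD u) sa.
have u4 : vr s4 vu = u by rewrite /s4 run_var.
have fj : eval s4 (EOr (EAt aD vu) (EVar vd)) = f j.
  rewrite eval_or /= u4 D4 r2 !lt0b /f -[j]/(nat_of_ord u) bitE !inE.
  congr (nat_of_bool (_ || (_ && _))).
  apply/forallP/subsetP => h w.
    by move=> wS; have := h w; rewrite wS !inE.
  by apply/implyP => /h; rewrite !inE.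
rewrite expnS mulnCA in i2.
have pos : 0 < 2 ^ j by rewrite expn_gt0.
set s5 := run (CSet vp (EDbl vp)) s4.
have q5 : vr s5 vp = q + q.
  by rewrite -[LHS]/(minn (vr s4 vp + vr s4 vp) (cp s4)) q4; nia.
have E : run (CSet vd (EVar vne);; c_row;; CSet vp (EDbl vp);;
    CSet vp (EAdd (EVar vp) (EOr (EAt aD vu) (EVar vd)))) (setv s2 vu j) =
    setv s5 vp (minn (vr s5 vp + eval s4 (EOr (EAt aD vu) (EVar vd))) (cp s4)).
  by [].
have hs : minn (q + q + f j) (cp s4) = q + q + f j by case: (f j); nia.
rewrite E q5 fj hs; split.
- by rewrite -[LHS]/(vr s4 ve) r1.
- by rewrite -i1.
- by rewrite /=; case: (f j); nia.
- rewrite -[vr _ vok]/(vr s4 vok) r3 -[vr s3 vok]/(vr s2 vok) i3.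
  by rewrite -[j]/(nat_of_ord u) upto_step -!andbA [X in _ && X]andbC.
Qed.

Definition try_ok (j : 'I_n) (X S : {set 'I_n}) : bool :=
  [&& [disjoint S & X], (S != set0) ==> ((j \notin M) || (j \in A)) &
      independent G S].

Lemma c_try_ok s (j : 'I_n) (X D S : {set 'I_n}) : env s ->
  rep s aX X -> rep s aD D -> rep s aS S -> vr s vj = j ->
  forall i, ar (run c_try s) aT i =
    if [&& 0 < ar s aT (code j.+1 X D), try_ok j X S &
           i == code j (X :|: S) (D :|: dominators G S)] then 1
    else ar s aT i.
Proof.
move=> es hX hD hS ej i; rewrite /c_try.
set s1 := run c_lookup s.
have v1 : vr s1 vok = ar s aT (code j.+1 X D) by apply: c_lookup_ok.
have es1 : env s1 by apply: env_run.
have hX1 : rep s1 aX X by apply: rep_run.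
have hD1 : rep s1 aD D by apply: rep_run.
have hS1 : rep s1 aS S by apply: rep_run.
have ej1 : vr s1 vj = j by rewrite /s1 run_var.
have t1 : ar s1 aT i = ar s aT i by rewrite /s1 run_arr.
have [n2 v2] := c_disjoint_ok es1 hX1 hS1.
set s2 := run c_disjoint s1 in n2 v2.
have es2 : env s2 by apply: env_run.
have hX2 : rep s2 aX X by apply: rep_run.
have hD2 : rep s2 aD D by apply: rep_run.
have hS2 : rep s2 aS S by apply: rep_run.
have ej2 : vr s2 vj = j by rewrite /s2 run_var.
have t2 : ar s2 aT i = ar s aT i by rewrite /s2 run_arr.
have v3 := c_allowed_ok es2 ej2 n2.
set s3 := run c_allowed s2 in v3.
have es3 : env s3 by apply: env_run.
have hX3 : rep s3 aX X by apply: rep_run.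
have hD3 : rep s3 aD D by apply: rep_run.
have hS3 : rep s3 aS S by apply: rep_run.
have ej3 : vr s3 vj = j by rewrite /s3 run_var.
have n3 : vr s3 vne = (S != set0) by rewrite /s3 run_var.
have t3 : ar s3 aT i = ar s aT i by rewrite /s3 run_arr.
set s4 := run (CSet vp (EVar vj)) s3.
have es4 : env s4 by apply: env_run.
have p4 : vr s4 vp = j by [].
have ltj := ltn_ord j.
set e := EOr (EAt aX vv) (EAt aS vv).
have p5 : vr (run (c_enc e) s4) vp = enc j (bit (X :|: S)) n.
  rewrite -p4; apply: enc_ok; first exact: env_n.
    by rewrite p4 cap_enc1 // ltnW.
  move=> k s' ltk ek [_ sa _]; rewrite eval_or /= ek !sa //.
  pose w := Ordinal ltk; rewrite -[k]/(nat_of_ord w).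
  by rewrite -[ar s4 aX _]/(ar s3 aX w) -[ar s4 aS _]/(ar s3 aS w) hX3 hS3 bitE inE !lt0b.
set s5 := run (c_enc e) s4 in p5.
have es5 : env s5 by apply: env_run.
have hD5 : rep s5 aD D by apply: rep_run.
have hS5 : rep s5 aS S by apply: rep_run.
have n5 : vr s5 vne = (S != set0) by rewrite /s5 run_var.
have t5 : ar s5 aT i = ar s aT i by rewrite /s5 run_arr.
have v5 : vr s5 vok = vr s3 vok by rewrite /s5 run_var.
have c5 : (enc j (bit (X :|: S)) n).+1 * 2 ^ n <= cp s5.
  apply: leq_trans (cap_enc es5 (ltnW ltj)).
  by rewrite leq_mul2r; apply/orP; right; apply: enc_lt.
have [p6 v6] := c_neighbors_ok es5 hS5 hD5 n5 p5 c5.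
set s6 := run c_neighbors s5 in p6 v6.
have t6 : ar s6 aT i = ar s aT i by rewrite /s6 run_arr.
rewrite 6!run_seq -/s1 -/s2 -/s3 -/s4 -/e -/s5 -/s6.
clearbody s6.
rewrite /= v6 v5 v3 v2 v1 /try_ok -!andbA.
case: (0 < _) => //=; case: [disjoint _ & _] => //=; case: (_ ==> _) => //=.
by case: (independent _ _) => //=; rewrite eqn_eq p6 t6.
Qed.

End Transition.

(** * Running through all triples *)

Fixpoint cnt (f : nat -> bool) (k : nat) : nat :=
  if k is k'.+1 then f k' + cnt f k' else 0.

Fixpoint value (f b : nat -> bool) (k : nat) : nat :=
  if k is k'.+1 then
    if f k' then b k' + 2 * value f b k' else value f b k'
  else 0.

Lemma cnt_mono f j k : j <= k -> cnt f j <= cnt f k.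
Proof.
elim: k => [|k IHk]; first by rewrite leqn0 => /eqP->.
rewrite leq_eqVlt => /orP[/eqP-> //|lt]; apply: leq_trans (IHk lt) _.
exact: leq_addl.
Qed.

Lemma value_lt f b k : value f b k < 2 ^ cnt f k.
Proof.
elim: k => //= k IHk; case: (f k) => //=; rewrite expnD expn1.
by case: (b k); lia.
Qed.

Lemma value_inj f b b' k : value f b k = value f b' k ->
  forall i, i < k -> f i -> b i = b' i.
Proof.
elim: k => //= k IHk e i; rewrite ltnS leq_eqVlt => lti fi.
case: (boolP (f k)) e => fk e.
  have [e1 e2] : b k = b' k /\ value f b k = value f b' k.
    by move: e; case: (b k); case: (b' k); lia.
  by case/orP: lti => [/eqP-> //|lti]; apply: IHk.
case/orP: lti => [/eqP ei|lti]; last exact: IHk.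
by rewrite -ei fi in fk.
Qed.

Lemma eq_value f b b' k : (forall i, i < k -> b i = b' i) ->
  value f b k = value f b' k.
Proof.
elim: k => //= k IHk h; rewrite h // IHk // => i lti.
by apply: h; apply: ltnW.
Qed.

Lemma value_flip (f b b' : nat -> bool) j k : j < k -> f j -> b j = false -> b' j ->
  (forall i, i != j -> b i = b' i) ->
  value f b' k = value f b k + 2 ^ (cnt f k - cnt f j.+1).
Proof.
move=> + fj bj b'j h; elim: k => //= k IHk; rewrite ltnS leq_eqVlt.
case/orP=> [/eqP ej|ltj].
  rewrite -ej fj bj b'j subnn expn0 -(@eq_value f b b') ?addn1 ?add1n //.
  by move=> i lti; apply: h; rewrite neq_ltn lti.
have nk : k != j by rewrite neq_ltn ltj orbT.
have le := cnt_mono f ltj; rewrite /= fj in le.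
rewrite /= fj in IHk; rewrite fj h // IHk //; case: (f k) => //.
rewrite (_ : true + cnt f k - (true + cnt f j) = (cnt f k - (true + cnt f j)).+1).
  by rewrite expnS; lia.
by move: le; rewrite /=; lia.
Qed.

Section Odometer.

Variables (n : nat).

Lemma rep_puta s B (X : {set 'I_n}) (v : 'I_n) (b : bool) : rep s B X ->
  rep (puta s B v b) B (if b then v |: X else X :\ v).
Proof.
move=> h u /=; rewrite !eqn_eq eqxx /= h val_eqE.
by case: b; rewrite !inE; case: (u == v).
Qed.

Lemma incr_ok B F s (FS BS : {set 'I_n}) (c : bool) : B != F ->
  vr s vn = n -> rep s F FS -> rep s B BS -> vr s vc = c ->
  let s' := run (c_incr B F) s in
  exists (BS' : {set 'I_n}) (c' : bool),
    [/\ rep s' B BS', vr s' vc = c', BS' :\: FS = BS :\: FS &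
        value (bit FS) (bit BS') n + 2 ^ cnt (bit FS) n * c' =
        value (bit FS) (bit BS) n + c].
Proof.
move=> nBF en hF hB hc s'; rewrite {}/s'.
set f := bit FS.
pose I j s' := exists (BS' : {set 'I_n}) (c' : bool),
    [/\ rep s' B BS', vr s' vc = c', BS' :\: FS = BS :\: FS &
        value f (bit BS') n + 2 ^ (cnt f n - cnt f j) * c' =
        value f (bit BS) n + c].
suff [BS' [c' [h1 h2 h3 h4]]] : I 0 (run (c_incr B F) s).
  by exists BS', c'; rewrite subn0 in h4.
apply: run_for => [|j s2].
  by rewrite en; exists BS, c; split=> //; rewrite subnn mul1n.
rewrite en => ltj [_ sa _] [X [d [h1 h2 h3 h4]]].
pose v := Ordinal ltj.
have eF : ar s2 F j = (v \in FS).
  by rewrite -(hF v) sa //= !inE orbb eq_sym.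
have eB : ar s2 B j = (v \in X) by rewrite -(h1 v).
have fj : f j = (v \in FS) by rewrite -bitE.
have le := cnt_mono f ltj; rewrite /= in le.
have h1' : rep (setv s2 vv j) B X by [].
rewrite /= eF lt0b; case: ifP => vF; last first.
  by exists X, d; split=> //; rewrite -h4 /= fj vF.
rewrite fj vF in le.
rewrite /= h2 lt0b; case: ifP => dT; last first.
  by exists X, d; split=> //; rewrite -h4 dT !muln0.
rewrite dT muln1 in h4.
have ef : cnt f j.+1 = (cnt f j).+1 by rewrite /= fj vF.
have ee : cnt f n - cnt f j = (cnt f n - cnt f j.+1).+1 by rewrite ef; lia.
rewrite eB lt0b; case: ifP => vX.
  exists (X :\ v), true; split.
  - exact: (rep_puta v false h1').
  - by rewrite /= h2 dT.
  - rewrite -h3; apply/setP => u; rewrite !inE; case: (u =P v) => [->|_] //.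
    by rewrite vF.
  - have fl : value f (bit X) n =
        value f (bit (X :\ v)) n + 2 ^ (cnt f n - cnt f j.+1).
      apply: value_flip => //; rewrite ?fj -?[j]/(nat_of_ord v) ?bitE ?inE ?eqxx //.
      move=> i ni; rewrite /bit; case: insubP => // w _ ew.
      by rewrite !inE -val_eqE /= ew (negPf ni).
    by rewrite -h4 fl ee expnS muln1; lia.
exists (v |: X), false; split.
- exact: (rep_puta v true h1').
- by [].
- rewrite -h3; apply/setP => u; rewrite !inE; case: (u =P v) => [->|_] //.
  by rewrite vF.
- have fl : value f (bit (v |: X)) n =
      value f (bit X) n + 2 ^ (cnt f n - cnt f j.+1).
    apply: value_flip => //; rewrite ?fj -?[j]/(nat_of_ord v) ?bitE ?inE ?eqxx //.
    move=> i ni; rewrite /bit; case: insubP => // w _ ew.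
    by rewrite !inE -val_eqE /= ew (negPf ni).
  by rewrite -h4 fl muln0 addn0; lia.
Qed.

Variables (M K : {set 'I_n}).

Notation mM := (cnt (bit M) n).
Notation mK := (cnt (bit K) n).

Definition period := 2 ^ (mM + (mK + mM)).

Definition val3 (X D S : {set 'I_n}) : nat :=
  value (bit M) (bit X) n + 2 ^ mM * (value (bit K) (bit D) n +
    2 ^ mK * value (bit M) (bit S) n).

Lemma val3_lt X D S : val3 X D S < period.
Proof.
rewrite /val3 /period !expnD.
have h1 := value_lt (bit M) (bit X) n; have h2 := value_lt (bit K) (bit D) n.
have h3 := value_lt (bit M) (bit S) n.
move: h1 h2 h3; move: (value _ _ _) (value _ _ _) (value _ _ _) => x d s.
move: (2 ^ mM) (2 ^ mK) => a b h1 h2 h3.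
have : d + b * s < b * a by nia.
by nia.
Qed.

Lemma value_set_inj (F X Y : {set 'I_n}) :
  value (bit F) (bit X) n = value (bit F) (bit Y) n ->
  X :\: F = Y :\: F -> X = Y.
Proof.
move=> /value_inj h /setP e; apply/setP => v; have := e v; rewrite !inE.
case: (boolP (v \in F)) => //= vF _.
by have := h v (ltn_ord v); rewrite !bitE => ->.
Qed.

Lemma val3_inj X D S X' D' S' : val3 X D S = val3 X' D' S' ->
  X :\: M = X' :\: M -> D :\: K = D' :\: K -> S :\: M = S' :\: M ->
  [/\ X = X', D = D' & S = S'].
Proof.
rewrite /val3 => e eX eD eS.
have split2 a x y x' y' : x < a -> x' < a -> x + a * y = x' + a * y' ->
    x = x' /\ y = y'.
  move=> l1 l2 ee; have a0 : 0 < a by lia.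
  have ey : y = y'.
    by have := congr1 (divn^~ a) ee; rewrite /= !(mulnC a) !divnDMl // !divn_small.
  by split=> //; rewrite ey in ee; lia.
have [e1 e2] := split2 _ _ _ _ _ (value_lt _ _ _) (value_lt _ _ _) e.
have [e3 e4] := split2 _ _ _ _ _ (value_lt _ _ _) (value_lt _ _ _) e2.
by split; [apply: value_set_inj e1 eX | apply: value_set_inj e3 eD
          | apply: value_set_inj e4 eS].
Qed.

Lemma c_next_ok s (X D S : {set 'I_n}) : vr s vn = n ->
  rep s aM M -> rep s aK K -> rep s aX X -> rep s aD D -> rep s aS S ->
  let s' := run c_next s in
  exists X' D' S' : {set 'I_n},
  [/\ [/\ rep s' aX X', rep s' aD D' & rep s' aS S'],
      [/\ X' :\: M = X :\: M, D' :\: K = D :\: K & S' :\: M = S :\: M] &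
      val3 X' D' S' = (val3 X D S).+1 %% period].
Proof.
move=> en hM hK hX hD hS s'; rewrite {}/s' /c_next.
set s1 := run (CSet vc (EBit true)) s.
have [X' [c1 [h1 h2 h3 h4]]] := @incr_ok aX aM s1 M X true isT en hM hX erefl.
set s2 := run (c_incr aX aM) s1 in h1 h2.
have en2 : vr s2 vn = n by rewrite /s2 run_var.
have hK2 : rep s2 aK K by apply: rep_run.
have hD2 : rep s2 aD D by apply: rep_run.
have [D' [c2 [k1 k2 k3 k4]]] := @incr_ok aD aK s2 K D c1 isT en2 hK2 hD2 h2.
set s3 := run (c_incr aD aK) s2 in k1 k2.
have en3 : vr s3 vn = n by rewrite /s3 run_var.
have hM3 : rep s3 aM M by do 2 apply: rep_run => //.
have hS3 : rep s3 aS S by do 2 apply: rep_run => //.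
have [S' [c3 [l1 l2 l3 l4]]] := @incr_ok aS aM s3 M S c2 isT en3 hM3 hS3 k2.
exists X', D', S'; split=> //.
  split=> //; last exact: (rep_run (c := c_incr aS aM) (s := s3)).
  apply: (rep_run (c := c_incr aS aM) (s := s3)) => //.
  exact: (rep_run (c := c_incr aD aK) (s := s2)).
have lt := val3_lt X' D' S'.
suff e : val3 X' D' S' + period * c3 = (val3 X D S).+1.
  by rewrite -e mulnC addnC modnMDl modn_small.
rewrite /val3 /period !expnD.
move: h4 k4 l4; move: (value _ (bit X') _) (value _ (bit X) _).
move: (value _ (bit D') _) (value _ (bit D) _).
move: (value _ (bit S') _) (value _ (bit S) _) => y3 x3 y2 x2 y1 x1.
move: (2 ^ mM) (2 ^ mK) => a b e1 e2 e3.
have {}e2 := congr1 (muln a) e2.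
have {}e3 := congr1 (fun z => a * (b * z)) e3.
rewrite /= in e3; lia.
Qed.

End Odometer.

(** * Filling the table *)

Section MainLoop.

Variables (n : nat) (G : sgraph 'I_n) (M A : {set 'I_n}).

Notation K := (tracked M).
Notation N := (period M K).
Notation env := (env G M A).

Definition passed (j : nat) : {set 'I_n} := [set v | (v \notin M) && (j <= v)].

Definition conf (j : 'I_n) (X D S : {set 'I_n}) : Prop :=
  [/\ X :\: M = passed j.+1, D :\: K = ~: K & S :\: M = [set j] :\: M].

Definition hit (T : nat -> nat) (j : 'I_n) (X' D' X D S : {set 'I_n}) : Prop :=
  [/\ 0 < T (code j.+1 X D), try_ok G M A j X S, X' = X :|: S &
      D' = D :|: dominators G S].

Lemma odometer_ok s (j : 'I_n) (X D S : {set 'I_n}) : env s -> vr s vN = N ->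
  vr s vj = j -> rep s aX X -> rep s aD D -> rep s aS S -> conf j X D S ->
  let s' := run (CFor vit vN (c_try ;; c_next)) s in
  [/\ exists X1 D1 S1 : {set 'I_n}, [/\ rep s' aX X1, rep s' aD D1, rep s' aS S1 & conf j X1 D1 S1],
      forall (j' : nat) (X' D' : {set 'I_n}), j' != j ->
        ar s' aT (code j' X' D') = ar s aT (code j' X' D') &
      forall X' D' : {set 'I_n}, 0 < ar s' aT (code j X' D') <->
        0 < ar s aT (code j X' D') \/
        exists X1 D1 S1, conf j X1 D1 S1 /\ hit (ar s aT) j X' D' X1 D1 S1].
Proof.
move=> es eN ej hX hD hS cf s'; rewrite {}/s'.
set v0 := val3 M K X D S.
have v0N : v0 < N by apply: val3_lt.
pose I i s' := [/\ i <= N, exists X1 D1 S1 : {set 'I_n},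
       [/\ [/\ rep s' aX X1, rep s' aD D1 & rep s' aS S1], conf j X1 D1 S1 &
           val3 M K X1 D1 S1 = (v0 + (N - i)) %% N],
      forall (j' : nat) (X' D' : {set 'I_n}), j' != j ->
        ar s' aT (code j' X' D') = ar s aT (code j' X' D') &
      forall X' D' : {set 'I_n}, 0 < ar s' aT (code j X' D') <->
        0 < ar s aT (code j X' D') \/
        exists X1 D1 S1 t, [/\ conf j X1 D1 S1, t < N - i,
          val3 M K X1 D1 S1 = (v0 + t) %% N & hit (ar s aT) j X' D' X1 D1 S1]].
suff [_ [X1 [D1 [S1 [[r1 r2 r3] c1 _]]]] h1 h2] :
    I 0 (run (CFor vit vN (c_try ;; c_next)) s).
  split=> //; first by exists X1, D1, S1.
  move=> X' D'; rewrite h2; split=> -[h|]; try by left.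
    case=> X2 [D2 [S2 [t [k1 _ _ k4]]]]; right.
    by exists X2, D2, S2.
  case=> X2 [D2 [S2 [k1 k2]]]; right; exists X2, D2, S2.
  have lt := val3_lt M K X2 D2 S2; set w := val3 M K X2 D2 S2 in lt.
  exists ((w + (N - v0)) %% N); rewrite subn0; split=> //.
    by rewrite ltn_mod; lia.
  by rewrite modnDmr addnCA subnKC ?(ltnW v0N) // modnDr modn_small.
apply: run_for => [|i s2]; rewrite eN.
  split=> //.
    exists X, D, S; split; [by split | by [] |].
    by rewrite subnn addn0 modn_small.
  move=> X' D'; rewrite subnn; split; first by left.
  by case=> // -[? [? [? [t []]]]].
move=> lti so [_ [X1 [D1 [S1 [[r1 r2 r3] c1 v1]]]] h1 h2].
have es2 : env s2 by apply: env_out so _ es.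
have ej2 : vr s2 vj = j by have [sv _ _] := so; rewrite sv.
set s3 := setv s2 vit i.
have es3 : env s3 by apply: env_setv.
have T4 := c_try_ok es3 (r1 : rep s3 aX X1) (r2 : rep s3 aD D1)
             (r3 : rep s3 aS S1) ej2.
set s4 := run c_try s3 in T4.
have es4 : env s4 by apply: env_run.
have q1 : rep s4 aX X1 by apply: rep_run.
have q2 : rep s4 aD D1 by apply: rep_run.
have q3 : rep s4 aS S1 by apply: rep_run.
have [X2 [D2 [S2 [z1 [o1 o2 o3] v2]]]] := c_next_ok (env_n es4) (env_M es4) (env_K es4) q1 q2 q3.
rewrite run_seq -/s4.
have T5 k : ar (run c_next s4) aT k = ar s4 aT k by rewrite run_arr.
have T3 k : ar s3 aT k = ar s2 aT k by [].
split.
- exact: ltnW.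
- exists X2, D2, S2; split=> //; first by case: c1 => a b c; rewrite /conf o1 o2 o3.
  rewrite v2 v1 -addn1 modnDml -addnA; congr (_ %% _); lia.
- move=> j' X' D' nj; rewrite T5 T4 !T3 (h1 j') //; case: ifP => // /and3P[_ _ /eqP].
  by move/code_inj => [e _ _]; rewrite e eqxx in nj.
- have nj : j.+1 != j by rewrite neq_ltn ltnSn orbT.
  move=> X' D'; rewrite T5 T4 !T3 h1 //.
  case: ifP => [/and3P[a1 a2 /eqP/code_inj[_ eX eD]]|nh]; split=> //.
  + move=> _; right; exists X1, D1, S1, (N - i.+1); split=> //.
    by rewrite -(subnSK lti).
  + case/h2 => [|[X3 [D3 [S3 [t [k1 k2 k3 k4]]]]]]; first by left.
    right; exists X3, D3, S3, t; split=> //.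
    by apply: leq_trans k2 _; apply: leq_sub2l.
  + case=> [h|[X3 [D3 [S3 [t [k1 k2 k3 k4]]]]]]; apply/h2; first by left.
    right; exists X3, D3, S3, t; split=> //.
    move: k2; rewrite -(subnSK lti) ltnS leq_eqVlt => /orP[/eqP et|//].
    have [e1 e2 e3] : [/\ X3 = X1, D3 = D1 & S3 = S1].
      case: k1 c1 => [b1 b2 b3] [d1 d2 d3].
      by apply: (@val3_inj _ M K); rewrite ?k3 ?v1 ?et ?b1 ?b2 ?b3 ?d1 ?d2 ?d3.
    case: k4; rewrite e1 e2 e3 => a1 a2 a3 a4.
    by rewrite a1 a2 a3 a4 eqxx in nh.
Qed.

Lemma reach_conf j X D : reach G M A j X D ->
  X :\: M = passed j /\ D :\: K = ~: K.
Proof.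
elim=> [|{}j {}X {}D S _ [e1 e2] /and4P[/subsetP h1 /implyP h2 _ _] _].
  split; apply/setP => v; rewrite !inE; last by rewrite andbb.
  by rewrite andbF leqNgt ltn_ord andbF.
split; apply/setP => v; rewrite !inE.
  have /setP/(_ v) := e1; rewrite !inE; case: (boolP (v \in M)) => //= vM ->.
  rewrite [in RHS]leq_eqVlt orbC; congr orb; apply/idP/eqP => [/h1|/val_inj ej].
    by rewrite !inE (negPf vM) orbF => /eqP->.
  by rewrite ej in h2 *; apply: h2.
have /setP/(_ v) := e2; rewrite !inE; case: (_ || _) => //=.
by move=> ->.
Qed.

Definition ready (j : nat) (s : state) : Prop :=
  [/\ exists X D S : {set 'I_n}, [/\ [/\ rep s aX X, rep s aD D & rep s aS S],
         X :\: M = passed j, D :\: K = ~: K & S :\: M = set0],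
      forall X D : {set 'I_n}, 0 < ar s aT (code j X D) <-> reach G M A j X D &
      forall j' (X D : {set 'I_n}), j' < j -> ar s aT (code j' X D) = 0].

Lemma c_slot_ok s (j : 'I_n) : env s -> vr s vN = N -> vr s vj = j ->
  ready j.+1 s -> ready j (run c_slot s).
Proof.
move=> es eN ej [[X [D [S [[hX hD hS] oX oD oS]]]] hT hT0].
set s1 := run (CPut aS (EVar vj) (ENot (EAt aM vj))) s.
pose S1 := if j \notin M then j |: S else S :\ j.
have E1 : s1 = puta s aS j (j \notin M).
  rewrite /s1 /run -[eval s (EVar vj)]/(vr s vj) eval_not /= ej (env_M es).
  by case: (j \in M).
have es1 : env s1 by apply: env_run.
have hX1 : rep s1 aX X by [].
have hD1 : rep s1 aD D by [].
have hS1 : rep s1 aS S1 by rewrite E1; apply: rep_puta.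
have c1 : conf j X D S1.
  split=> //; apply/setP => v; have /setP/(_ v) := oS; rewrite /S1 !inE.
  case: (boolP (v \in M)) => //= vM; case: (boolP (j \in M)) => jM; rewrite !inE => ->.
    by rewrite andbF; apply/esym/negP => /eqP e; rewrite e jM in vM.
  by rewrite orbF.
have [[X2 [D2 [S2 [r1 r2 r3 [o1 o2 o3]]]]] t1 t2] :=
  odometer_ok es1 (eN : vr s1 vN = N) ej hX1 hD1 hS1 c1.
set s2 := run (CFor _ _ _) s1 in r1 r2 r3 t1 t2.
have ej2 : vr s2 vj = j by rewrite /s2 run_var.
have es2 : env s2 by apply: env_run.
set s3 := run (CPut aX (EVar vj) (EOr (EAt aX vj) (ENot (EAt aM vj)))) s2.
have E3 : s3 = puta s2 aX j ((j \in X2) || (j \notin M)).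
  rewrite /s3 /run -[eval s2 (EVar vj)]/(vr s2 vj) eval_or eval_not /= ej2 r1 (env_M es2).
  by case: (j \in M); case: (j \in X2).
pose X3 := if (j \in X2) || (j \notin M) then j |: X2 else X2 :\ j.
have hX3 : rep s3 aX X3 by rewrite E3; apply: rep_puta.
set s4 := run (CPut aS (EVar vj) (EBit false)) s3.
have E4 : s4 = puta s3 aS j false by rewrite -ej2.
have hS4 : rep s4 aS (S2 :\ j) by rewrite E4; apply: (rep_puta j false).
rewrite /c_slot !run_seq -/s1 -/s2 -/s3 -/s4.
have T1 k : ar s1 aT k = ar s aT k by [].
have T4 k : ar s4 aT k = ar s2 aT k by [].
split.
- exists X3, D2, (S2 :\ j); split=> //.
  + apply/setP => v; have /setP/(_ v) := o1; rewrite /X3 !inE.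
    case: (boolP (v \in M)) => //= vM e.
    rewrite [in RHS]leq_eqVlt; case: (v =P j) => [ev|/eqP nv].
      by rewrite ev in vM *; rewrite vM orbT !inE !eqxx.
    have -> : (nat_of_ord j == v) = false by apply/negP => /eqP/val_inj ejv; rewrite ejv eqxx in nv.
    by case: ifP => _; rewrite !inE (negPf nv) e.
  + apply/setP => v; have /setP/(_ v) := o3; rewrite !inE.
    by case: (v \in M) => //= ->; case: (v == j).
- move=> X' D'; rewrite T4 t2 T1 hT0 //; split.
    case=> // -[X5 [D5 [S5 [[b1 b2 b3] [/hT a1 /and3P[a2 a3 a4] -> ->]]]]].
    apply: ReachStep => //; apply/and4P; split=> //.
      apply/subsetP => v vS; rewrite !inE; have /setP/(_ v) := b3; rewrite !inE vS.
      by case: (v \in M); rewrite ?orbT //= => <-.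
    by apply/implyP => jM; have /setP/(_ j) := b3; rewrite !inE jM eqxx.
  move=> r; right.
  have [[e _ _]|[j5 [X5 [D5 [S5 [/val_inj ejj r5 [ok5 dis5] -> ->]]]]]] := reach_inv r.
    by have := ltn_ord j; rewrite e ltnn.
  rewrite -ejj in r5 ok5; exists X5, D5, S5.
  have [q1 q2] := reach_conf r5.
  have /and4P[/subsetP p1 /implyP p2 p3 p4] := ok5.
  split; last by split=> //; [apply/hT | apply/and3P].
  split=> //; apply/setP => v; rewrite !inE.
  case: (boolP (v \in M)) => //= vM; apply/idP/eqP => [/p1|ev].
    by rewrite !inE (negPf vM) orbF => /eqP.
  by rewrite ev in vM *; apply: p2.
- move=> j' X' D' ltj'; rewrite T4 t1 ?T1 ?hT0 //; first exact: ltnW.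
  by rewrite neq_ltn ltj'.
Qed.

End MainLoop.

(** * Reading and preparing the input *)

Lemma cnt_le f k : cnt f k <= k.
Proof. by elim: k => //= k; case: (f k); lia. Qed.

Lemma cnt_card n (X : {set 'I_n}) : cnt (bit X) n = #|X|.
Proof.
have gen f k : cnt f k = \sum_(i < k) f i.
  elim: k => [|k IHk] /=; first by rewrite big_ord0.
  by rewrite big_ord_recr /= IHk addnC.
rewrite gen -sum1_card [RHS]big_mkcond /=; apply: eq_bigr => v _.
by rewrite bitE; case: (v \in X).
Qed.

Lemma c_grow_ok s : let s' := run c_grow s in
  cp s' = cp s * 8 ^ vr s vn /\ ip s' = ip s.
Proof.
pose I k s' := cp s' * 8 ^ k = cp s * 8 ^ vr s vn /\ ip s' = ip s.
have [] : I 0 (run c_grow s); last by rewrite muln1.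
apply: run_for => [|k s2 _ _ [i1 i2]] //; split=> //=.
by rewrite -i1 expnS; lia.
Qed.

Section Input.

Variable n : nat.

Lemma c_fill_ok B s e (w : seq nat) : vr s vn = n -> vr s ve = e -> e + n <= cp s ->
  ip s = drop e w -> (forall i, i < e -> ar s B i = nth 0 w i) ->
  let s' := run (c_fill B) s in
  [/\ vr s' ve = e + n, ip s' = drop (e + n) w &
      forall i, i < e + n -> ar s' B i = nth 0 w i].
Proof.
move=> en ee hc hw hB s'; rewrite {}/s'.
pose I k s' := [/\ k <= n, vr s' ve = e + (n - k), ip s' = drop (e + (n - k)) w &
      forall i, i < e + (n - k) -> ar s' B i = nth 0 w i].
suff [_] : I 0 (run (c_fill B) s) by rewrite subn0.
apply: run_for => [|k s2]; first by rewrite en /I subnn addn0.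
rewrite en => ltk [_ _ sc] [_ i1 i2 i3].
have E : e + (n - k) = (e + (n - k.+1)).+1 by lia.
have hd : head 0 (ip s2) = nth 0 w (e + (n - k.+1)).
  by rewrite i2 -nth0 nth_drop addn0.
split; first exact: ltnW.
- by rewrite /= i1; lia.
- by rewrite /= i2 E -drop1 drop_drop.
- move=> i; rewrite E ltnS leq_eqVlt /= i1 !eqn_eq eqxx /= => /orP[/eqP->|lti].
    by rewrite eqxx hd.
  by rewrite ifF ?i3 //; apply/eqP => ei; rewrite ei ltnn in lti.
Qed.

Lemma c_graph_ok s (w : seq nat) : vr s vn = n -> n * n <= cp s -> ip s = w ->
  let s' := run c_graph s in
  [/\ vr s' vnn = n * n, ip s' = drop (n * n) w &
      forall i, i < n * n -> ar s' aG i = nth 0 w i].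
Proof.
move=> en hc hw s'; rewrite {}/s'.
set s1 := run (CSet ve (EBit false)) s.
set c := CFor vu vn (c_fill aG).
rewrite /c_graph !run_seq -/c -/s1.
pose I k s' := [/\ k <= n, vr s' ve = (n - k) * n, ip s' = drop ((n - k) * n) w &
      forall i, i < (n - k) * n -> ar s' aG i = nth 0 w i].
suff [_] : I 0 (run c s1) by rewrite subn0.
have en1 : vr s1 vn = n by [].
apply: run_for => [|k s2]; first by rewrite en1 /I subnn mul0n drop0; split.
rewrite en1 => ltk [sv _ sc] [_ i1 i2 i3].
have E : (n - k) * n = (n - k.+1) * n + n.
  by rewrite (_ : n - k = (n - k.+1).+1) ?mulSn 1?addnC //; lia.
have en3 : vr (setv s2 vu k) vn = n by rewrite /= sv.
have c3 : (n - k.+1) * n + n <= cp (setv s2 vu k).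
  rewrite -E; apply: leq_trans (leq_trans _ hc) sc.
  by rewrite leq_mul2r leq_subr orbT.
by rewrite /I E; have [? ? ?] := c_fill_ok en3 i1 c3 i2 i3; split=> //; apply: ltnW.
Qed.

Lemma c_modulator_ok s (w : seq nat) : vr s vn = n -> n <= cp s -> ip s = w ->
  let s' := run c_modulator s in forall i, i < n -> ar s' aM i = nth 0 w i.
Proof.
move=> en hc hw s'; rewrite {}/s' /c_modulator run_seq.
set s1 := run _ s.
have h : ip s1 = drop 0 w by rewrite drop0.
by have [] := @c_fill_ok aM s1 0 w en erefl hc h.
Qed.

End Input.

Section Prepare.

Variables (n : nat) (M : {set 'I_n}) (l : nat).

Notation K := (tracked M).

Lemma bitC (X : {set 'I_n}) i : i < n -> bit (~: X) i = ~~ bit X i.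
Proof. by move=> lti; rewrite -[i]/(nat_of_ord (Ordinal lti)) !bitE inE. Qed.

Lemma c_count_ok s : vr s vn = n -> rep s aM M -> n <= cp s -> vr s vl = l ->
  let s' := run c_count s in
  [/\ vr s' vq = #|~: M|, vr s' vtrk = (#|~: M| <= #|M|) & vr s' vb = l - #|~: M|].
Proof.
move=> en hM hc hl s'; rewrite {}/s' /c_count !run_seq.
set s1 := run _ (run _ s); set c := CFor _ _ _.
pose I k s' := vr s' vk + cnt (bit M) k = cnt (bit M) n /\
               vr s' vq + cnt (bit (~: M)) k = cnt (bit (~: M)) n.
have c1 := leq_trans (cnt_le (bit M) n) hc.
have c2 := leq_trans (cnt_le (bit (~: M)) n) hc.
have [] : I 0 (run c s1).
  have en1 : vr s1 vn = n by [].
  apply: run_for => [|k s2]; rewrite en1; first by [].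
  move=> ltk [_ sa sc] [i1 i2]; rewrite /= in sc.
  have eM : ar s2 aM k = bit M k by rewrite sa // -(rep_lt hM ltk).
  rewrite /= !bitC // in i2; rewrite /= in i1; rewrite /I /= eM lt0b.
  by case: (bit M k) i1 i2 => /= i1 i2; split; lia.
rewrite !addn0 !cnt_card => e1 e2.
have hl' : vr (run c s1) vl = l by rewrite run_var.
set s2 := run c s1 in e1 e2 hl' *; clearbody s2.
rewrite /= e1 e2 hl'; split=> //.
by case: leqP => h /=; lia.
Qed.

Lemma c_flags_ok s : vr s vn = n -> rep s aM M ->
  vr s vtrk = (#|~: M| <= #|M|) ->
  let s' := run c_flags s in rep s' aK K /\ rep s' aD (~: K).
Proof.
move=> en hM ht s'; rewrite {}/s'.
pose I k s' := (forall v : 'I_n, k <= v -> ar s' aK v = (v \in K)) /\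
               (forall v : 'I_n, k <= v -> ar s' aD v = (v \in ~: K)).
suff [h1 h2] : I 0 (run c_flags s) by split=> v; [apply: h1 | apply: h2].
apply: run_for => [|k s2]; rewrite en.
  by split=> v; rewrite leqNgt ltn_ord.
move=> ltk [sv sa _] [i1 i2]; pose u := Ordinal ltk.
have eM : ar s2 aM k = (u \in M) by rewrite sa // -(hM u).
have et : vr s2 vtrk = (#|~: M| <= #|M|) by rewrite sv.
have eK : eval (setv s2 vv k) (EOr (EAt aM vv) (EVar vtrk)) = (u \in K).
  by rewrite eval_or /= eM et !lt0b inE.
set s3 := run (CPut aK (EVar vv) (EOr (EAt aM vv) (EVar vtrk))) (setv s2 vv k).
have E3 : s3 = puta (setv s2 vv k) aK u (u \in K) by rewrite -eK.
rewrite run_seq -/s3 E3.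
split=> v /=; rewrite !eqn_eq leq_eqVlt => /orP[/eqP/(@val_inj _ _ _ u v)<-|lt].
- by rewrite eqxx.
- by rewrite ifF ?i1 //; apply/eqP => e; rewrite e ltnn in lt.
- by rewrite !eqxx in_setC; case: (u \in K).
- by rewrite ifF ?i2 //; apply/eqP => e; rewrite e ltnn in lt.
Qed.

Lemma c_budget_ok s : vr s vn = n -> rep s aM M -> rep s aA (set0 : {set 'I_n}) ->
  exists A : {set 'I_n}, [/\ rep (run c_budget s) aA A, A \subset M &
    #|A| = minn #|M| (vr s vb)].
Proof.
move=> en hM hA.
pose I k s' := exists A : {set 'I_n}, [/\ rep s' aA A,
   A \subset [set v in M | k <= v], #|A| + vr s' vb = vr s vb &
   0 < vr s' vb -> A = [set v in M | k <= v]].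
have E0 : [set v in M | 0 <= v] = M by apply/setP => v; rewrite inE andbT.
suff [A [h1 h2 h3 h4]] : I 0 (run c_budget s).
  rewrite E0 in h2 h4; exists A; split=> //.
  case: (posnP (vr (run c_budget s) vb)) h3 => [->|/h4 ->].
    by rewrite addn0 => <-; rewrite (minn_idPr _) // subset_leq_card.
  by move=> h3; rewrite (minn_idPl _) // -h3 leq_addr.
apply: run_for => [|k s2]; rewrite en.
  exists set0; split=> //; rewrite ?sub0set ?cards0 // => _.
  by apply/setP => v; rewrite !inE leqNgt ltn_ord andbF.
move=> ltk [sv sa _] [A [h1 h2 h3 h4]]; pose u := Ordinal ltk.
have eM : ar s2 aM k = (u \in M) by rewrite sa // -(hM u).
have sub : [set v in M | k < v] \subset [set v in M | k <= v].
  by apply/subsetP => v; rewrite !inE => /andP[-> /ltnW].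
have eku (v : 'I_n) : (k == v) = (v == u) by rewrite eq_sym -val_eqE.
have ext : u \in M -> [set v in M | k <= v] = u |: [set v in M | k < v].
  move=> uM; apply/setP => v; rewrite !inE leq_eqVlt eku.
  by case: eqP => [->|] //=; rewrite uM.
have ext' : u \notin M -> [set v in M | k <= v] = [set v in M | k < v].
  move=> uM; apply/setP => v; rewrite !inE leq_eqVlt eku.
  by case: eqP => [->|] //=; rewrite (negPf uM).
rewrite /= eM lt0b; case: ifP => uM; last first.
  by exists A; rewrite ext' ?uM.
rewrite /=; case: posnP => [b0|b0].
  exists A; split=> //=; first exact: subset_trans h2 sub.
  by rewrite b0.
have nA : u \notin A by apply/negP => /(subsetP h2); rewrite !inE ltnn andbF.
exists (u |: A); split=> /=.
- by move=> v; rewrite /= eqn_eq eq_sym eku !inE h1; case: (v == u).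
- by rewrite ext // setUS.
- by rewrite cardsU1 nA; lia.
- by move=> _; rewrite ext // h4.
Qed.

Lemma c_size_ok s : vr s vn = n -> rep s aM M -> rep s aK K -> 8 ^ n <= cp s ->
  vr (run c_size s) vN = period M K.
Proof.
move=> en hM hK hc; rewrite /c_size run_seq.
set s1 := run _ s; set c := CFor _ _ _.
pose ex k := cnt (bit M) k + (cnt (bit K) k + cnt (bit M) k).
pose I k s' := vr s' vN * 2 ^ ex k = period M K.
suff : I 0 (run c s1) by rewrite /I muln1.
have exn k : ex k <= 3 * k.
  by rewrite /ex; have := cnt_le (bit M) k; have := cnt_le (bit K) k; lia.
have pc : period M K <= cp s.
  apply: leq_trans hc; rewrite (_ : 8 = 2 ^ 3) // -expnM leq_exp2l //.
  exact: exn.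
have en1 : vr s1 vn = n by [].
apply: run_for => [|k s2]; rewrite en1; first by rewrite /I mul1n.
move=> ltk [_ sa sc]; rewrite /I => i1; rewrite /= in sc.
have eM : ar s2 aM k = bit M k by rewrite sa // -(rep_lt hM ltk).
have eK : ar s2 aK k = bit K k by rewrite sa // -(rep_lt hK ltk).
have e2 : ex k.+1 = (bit M k + bit M k + bit K k) + ex k by rewrite /ex /=; lia.
rewrite e2 expnD in i1; have pos : 0 < 2 ^ ex k by rewrite expn_gt0.
move: (2 ^ ex k) (period M K) i1 pos pc {e2 exn} => E P i1 pos pc.
set x := vr s2 vN in i1.
have le : x * 2 ^ (bit M k + bit M k + bit K k) <= cp s2.
  apply: leq_trans sc; apply: leq_trans pc; rewrite -i1 mulnA.
  by rewrite leq_pmulr.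
rewrite -i1 mulnA; congr (_ * _); rewrite /= eM lt0b.
case: (bit M k) le => le; rewrite /= eK lt0b; case: (bit K k) le => /= le;
  rewrite -/x /= in le *; lia.
Qed.

End Prepare.

Section Correctness.

Variables (n : nat) (G : sgraph 'I_n) (M A : {set 'I_n}).

Notation K := (tracked M).
Notation N := (period M K).
Notation env := (env G M A).

Lemma c_start_ok s : env s -> rep s aX (set0 : {set 'I_n}) -> rep s aD (~: K) ->
  rep s aS (set0 : {set 'I_n}) -> (forall i, ar s aT i = 0) ->
  ready G M A n (run c_start s).
Proof.
move=> es hX hD hS hT; rewrite /c_start !run_seq.
set s1 := run (CSet _ _) s.
have es1 : env s1 by apply: env_run.
have e1 : vr s1 vp = n by rewrite -(env_n es).
have := enc_pair es1 e1 (leqnn n) (hX : rep s1 aX set0) (hD : rep s1 aD (~: K)).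
set s2 := run _ (run _ s1) => e2.
have T2 i : ar s2 aT i = 0 by rewrite /s2 !run_arr.
have X2 : rep s2 aX (set0 : {set 'I_n}) by do 2 apply: rep_run => //.
have D2 : rep s2 aD (~: K) by do 2 apply: rep_run => //.
have S2 : rep s2 aS (set0 : {set 'I_n}) by do 2 apply: rep_run => //.
have E i : ar (run (CPut aT (EVar vp) (EBit true)) s2) aT i =
    if i == code n set0 (~: K) then 1 else 0.
  by rewrite /= eqn_eq e2 T2.
split.
- exists set0, (~: K), set0; split=> //.
  + by apply/setP => v; rewrite !inE andbF leqNgt ltn_ord andbF.
  + by apply/setP => v; rewrite !inE andbb.
  + by rewrite set0D.
- move=> X D; rewrite E; case: eqP => [/code_inj[_ -> ->]|ne].
    by split=> // _; apply: ReachInit.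
  split=> // /reach_inv[[_ eX eD]|[j [? [? [? [ej]]]]]].
    by case: ne; rewrite eX eD.
  by have := ltn_ord j; rewrite -ej ltnn.
- move=> j' X D ltj; rewrite E; case: eqP => // /code_inj[e _ _].
  by rewrite e ltnn in ltj.
Qed.

Lemma c_loop_ok s : env s -> vr s vN = N -> ready G M A n s ->
  ready G M A 0 (run (CFor vj vn c_slot) s).
Proof.
move=> es eN rd; apply: run_for; rewrite (env_n es) // => j s' ltj so rj.
have es' : env s' by apply: env_out so _ es.
have eN' : vr s' vN = N by case: so => sv _ _; rewrite sv.
exact: (@c_slot_ok _ _ _ _ _ (Ordinal ltj) (env_setv j _ es')).
Qed.

Lemma c_answer_ok s : env s -> ready G M A 0 s -> vr s vq = #|~: M| ->
  0 < vr (run c_answer s) vres <->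
  #|~: M| <= vr s vl /\ reach G M A 0 setT setT.
Proof.
move=> es [_ hT _] eq; rewrite /c_answer !run_seq.
set s1 := run (CSet _ _) s.
have es1 : env s1 by apply: env_run.
have one s' : vr s' vn = n -> (vr s' vp).+1 * 2 ^ n <= cp s' ->
    vr (run (c_enc (EBit true)) s') vp = enc (vr s' vp) (bit [set: 'I_n]) n.
  move=> en hc; apply: enc_ok => // j s2 ltj _ _ /=.
  by rewrite -[j]/(nat_of_ord (Ordinal ltj)) bitE inE.
have p1 : vr s1 vp = 0 by [].
have c1 := cap_enc1 es1 (leq0n n).
have p2 := one s1 (env_n es1) c1; rewrite p1 in p2.
set s2 := run (c_enc _) s1 in p2 *.
have es2 : env s2 by apply: env_run.
have c2 : (vr s2 vp).+1 * 2 ^ n <= cp s2.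
  apply: leq_trans (cap_enc es2 (leq0n n)); rewrite leq_mul2r p2.
  by apply/orP; right; apply: enc_lt.
have p3 := one s2 (env_n es2) c2; rewrite p2 in p3.
set s3 := run (c_enc _) s2 in p3 *.
have T3 : ar s3 aT (code 0 [set: 'I_n] [set: 'I_n]) = ar s aT (code 0 [set: 'I_n] [set: 'I_n]).
  by rewrite /s3 run_arr // /s2 run_arr.
have q3 : vr s3 vq = #|~: M| by rewrite /s3 run_var // /s2 run_var.
have l3 : vr s3 vl = vr s vl by rewrite /s3 run_var // /s2 run_var.
clearbody s3; rewrite /= q3 l3 p3 T3.
case: (leqP #|~: M| (vr s vl)) => h.
  rewrite (eqP (h : #|~: M| - vr s vl == 0)) /=.
  by split=> [/hT|[_ /hT]].
by rewrite subn_gt0 h /=; split=> // -[].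
Qed.

End Correctness.

Section Encoding.

Variables (n : nat) (G : sgraph 'I_n) (l : nat) (M : {set 'I_n}).

Definition graph_bits : seq nat :=
  [seq nat_of_bool (G u v) | u <- enum 'I_n, v <- enum 'I_n].

Definition set_bits : seq nat := [seq nat_of_bool (v \in M) | v <- enum 'I_n].

Lemma size_graph_bits : size graph_bits = n * n.
Proof. by rewrite size_allpairs -cardT card_ord. Qed.

Lemma size_set_bits : size set_bits = n.
Proof. by rewrite size_map -cardT card_ord. Qed.

Lemma nth_set_bits (v : 'I_n) : nth 0 set_bits v = (v \in M).
Proof. by rewrite (nth_map v) ?size_enum_ord // nth_ord_enum. Qed.

Lemma nth_graph_bits (u v : 'I_n) : nth 0 graph_bits (u * n + v) = G u v.
Proof.
have gen (T : Type) (f : T -> 'I_n -> nat) (s : seq T) x0 i : i < size s ->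
    nth 0 [seq f x y | x <- s, y <- enum 'I_n] (i * n + v) = f (nth x0 s i) v.
  elim: s i => //= x s IHs [|i] lti; rewrite nth_cat size_map size_enum_ord.
    by rewrite mul0n add0n ltn_ord (nth_map v) ?size_enum_ord // nth_ord_enum.
  by rewrite mulSn -addnA ltnNge leq_addr /= addKn IHs.
by rewrite /graph_bits (gen _ _ _ u) ?size_enum_ord // nth_ord_enum.
Qed.

Lemma encodeE : encode G l M = [:: n, l & graph_bits ++ set_bits].
Proof. by []. Qed.

Lemma sumn_encode : sumn (encode G l M) <= n + l + (n * n + n).
Proof.
have bits (w : seq nat) : all (leq^~ 1) w -> sumn w <= size w.
  by elim: w => //= a w IHw /andP[a1 /IHw]; lia.
rewrite encodeE /= sumn_cat -size_graph_bits -[X in _ + _ + (_ + X)]size_set_bits.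
rewrite addnA !leq_add2l; apply: leq_add; apply: bits; apply/allP => a.
  by case/allpairsP => -[u v] [_ _ ->]; apply: leq_b1.
by case/mapP => v _ ->; apply: leq_b1.
Qed.

End Encoding.

(** * Correctness and running time *)

Section Whole.

Variables (n : nat) (G : sgraph 'I_n) (l : nat) (M : {set 'I_n}).

Notation w := (encode G l M).
Notation K := (tracked M).

Notation s_read := (run (CRead vn) (start w)).
Notation s_input := (run c_input s_read).
Notation s_prepared := (run c_prepare s_input).

Lemma run_c_all : run c_all (start w) = run c_main s_prepared.
Proof. by rewrite /c_all run_seq4. Qed.

Lemma time_c_all_eq : time c_all (start w) =
  2 + (time c_input s_read + (time c_prepare s_input + time c_main s_prepared)).
Proof. by rewrite /c_all time_seq4. Qed.

Lemma n_s_read : vr s_read vn = n.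
Proof. by []. Qed.

Lemma n_s_input : vr s_input vn = n.
Proof. by rewrite run_var. Qed.

Lemma input_ok :
  [/\ vr s_input vl = l, vr s_input vnn = n * n,
      forall u v : 'I_n, ar s_input aG (u * n + v) = G u v,
      rep s_input aM M & n.+1 * 8 ^ n <= cp s_input].
Proof.
have [cpg ipg] := c_grow_ok s_read.
set s2 := run c_grow s_read in cpg ipg.
have {}cpg : cp s2 = n.+1 * 8 ^ n by rewrite cpg n_s_read.
have {}ipg : ip s2 = l :: graph_bits G ++ set_bits M by [].
have n2 : vr s2 vn = n by rewrite /s2 run_var.
rewrite /c_input 3!run_seq -/s2.
set s3 := run (CRead vl) s2.
have l3 : vr s3 vl = l by rewrite /s3 /= ipg.
have i3 : ip s3 = graph_bits G ++ set_bits M by rewrite /s3 /= ipg.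
have n3 : vr s3 vn = n by [].
have c3 : n.+1 * 8 ^ n <= cp s3 by rewrite -cpg; apply: run_cp_ge.
have lt8 : n <= 8 ^ n by apply: ltnW; apply: ltn_expl.
have nn3 : n * n <= cp s3 by apply: leq_trans c3; apply: leq_mul.
have [v4 i4 g4] := c_graph_ok n3 nn3 i3.
set s4 := run c_graph s3 in v4 i4 g4 *.
have n4 : vr s4 vn = n by rewrite /s4 run_var.
have c4 : n.+1 * 8 ^ n <= cp s4 by apply: leq_trans c3 (run_cp_ge _ _).
have {}i4 : ip s4 = set_bits M by rewrite i4 -(size_graph_bits G) drop_size_cat.
have nc4 : n <= cp s4 by apply: leq_trans c4; apply: leq_trans lt8 _; rewrite leq_pmull.
have m5 := c_modulator_ok n4 nc4 i4.
split.
- by rewrite run_var // /s4 run_var // l3.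
- by rewrite run_var.
- move=> u v; rewrite run_arr // g4; last first.
    by have := ltn_ord u; have := ltn_ord v; nia.
  rewrite nth_cat size_graph_bits ifT ?nth_graph_bits //.
  by have := ltn_ord u; have := ltn_ord v; nia.
- by move=> v; rewrite m5 // nth_set_bits.
- exact: leq_trans c4 (run_cp_ge _ _).
Qed.

Lemma input_zero B i : B != aG -> B != aM -> ar s_input B i = 0.
Proof.
move=> h1 h2; rewrite run_arr // !inE.
by rewrite (negPf h1) (negPf h2).
Qed.

Lemma prepare_ok :
  exists A : {set 'I_n},
    [/\ A \subset M /\ #|A| = minn #|M| (l - #|~: M|), env G M A s_prepared,
        vr s_prepared vN = period M K /\ vr s_prepared vl = l,
        vr s_prepared vq = #|~: M| & ready G M A n s_prepared].
Proof.
have [l5 nn5 g5 m5 c5] := input_ok; have n5 := n_s_input.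
have zero := input_zero.
rewrite /c_prepare 4!run_seq.
move: (s_input) l5 nn5 g5 m5 c5 n5 zero => s5 l5 nn5 g5 m5 c5 n5 zero.
have lt8 : n <= 8 ^ n by apply: ltnW; apply: ltn_expl.
have c8 : 8 ^ n <= cp s5 by apply: leq_trans c5; rewrite leq_pmull.
have nc5 : n <= cp s5 by apply: leq_trans c8.
have [q6 t6 b6] := c_count_ok n5 m5 nc5 l5.
set s6 := run c_count s5 in q6 t6 b6 *.
have n6 : vr s6 vn = n by rewrite /s6 run_var.
have m6 : rep s6 aM M by apply: rep_run.
have [k7 d7] := c_flags_ok n6 m6 t6.
set s7 := run c_flags s6 in k7 d7 *.
have n7 : vr s7 vn = n by rewrite /s7 run_var.
have m7 : rep s7 aM M by apply: rep_run.
have b7 : vr s7 vb = l - #|~: M| by rewrite /s7 run_var.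
have a7 : rep s7 aA (set0 : {set 'I_n}).
  by move=> v; rewrite /s7 /s6 !run_arr // zero // inE.
have [A [a8 sA cA]] := c_budget_ok n7 m7 a7; rewrite b7 in cA.
set s8 := run c_budget s7 in a8 *.
have n8 : vr s8 vn = n by rewrite /s8 run_var.
have m8 : rep s8 aM M by apply: rep_run.
have k8 : rep s8 aK K by apply: rep_run.
have c58 : cp s5 <= cp s8.
  by apply: leq_trans (run_cp_ge _ _); apply: leq_trans (run_cp_ge _ _); apply: run_cp_ge.
have N9 := c_size_ok n8 m8 k8 (leq_trans c8 c58).
set s9 := run c_size s8 in N9 *.
have es9 : env G M A s9.
  split.
  - by rewrite /s9 run_var.
  - by rewrite /s9 /s8 /s7 /s6 !run_var.
  - by move=> u v; rewrite /s9 /s8 /s7 /s6 !run_arr.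
  - exact: rep_run.
  - exact: rep_run.
  - exact: rep_run.
  - exact: leq_trans (leq_trans c5 c58) (run_cp_ge _ _).
exists A; split=> //.
- exact: env_run.
- by split; rewrite run_var // /s9 /s8 /s7 /s6 !run_var.
- by rewrite run_var // /s9 run_var // /s8 run_var // /s7 run_var.
apply: c_start_ok => //.
- by move=> v; rewrite /s9 /s8 /s7 /s6 !run_arr // zero // inE.
- by apply: rep_run => //; apply: rep_run.
- by move=> v; rewrite /s9 /s8 /s7 /s6 !run_arr // zero // inE.
- by move=> i; rewrite /s9 /s8 /s7 /s6 !run_arr // zero.
Qed.

Lemma c_all_ok : clique_modulator G M ->
  0 < vr (run c_all (start w)) vres <-> has_dominator_coloring G l.
Proof.
move=> cM; have [A [[sA cA] es [eN el] eq rd]] := prepare_ok.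
rewrite (reachP cM sA cA) run_c_all run_seq.
have rd0 := c_loop_ok es eN rd.
set s11 := run (CFor _ _ _) s_prepared in rd0 *.
have es11 : env G M A s11 by apply: env_run.
have q11 : vr s11 vq = #|~: M| by rewrite /s11 run_var.
have l11 : vr s11 vl = l by rewrite /s11 run_var.
by rewrite (c_answer_ok es11 rd0 q11) l11.
Qed.

Lemma cp_c_all : cp (run c_all (start w)) <= n.+1 * 8 ^ n + (n + l + (n * n + n)).
Proof.
have [cpg ipg] := c_grow_ok s_read.
rewrite run_c_all /c_input [run (c_grow ;; _) _]run_seq.
set c := CRead vl ;; c_graph ;; c_modulator.
set s2 := run c_grow s_read in cpg ipg *.
have h1 := @run_cp_le c s2 isT.
have h2 := @run_cp_le c_prepare (run c s2) isT.
have h3 := @run_cp_le c_main (run c_prepare (run c s2)) isT.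
apply: leq_trans (leq_addr _ _) _; apply: leq_trans h3 _.
apply: leq_trans h2 _; apply: leq_trans h1 _.
rewrite cpg n_s_read ipg leq_add //; apply: leq_trans (sumn_encode G l M).
by rewrite encodeE /= leq_addl.
Qed.

Definition fixed_loops (c : com) : bool :=
  all (fun u => (u \in [:: vn; vN]) && (u \notin mod_vars c)) (loop_vars c).

Lemma fixed_time c s b : fixed_loops c -> vr s vn = n -> 0 < b ->
  (vN \in loop_vars c -> vr s vN <= b) ->
  time c s <= weight c * (n.+1 ^ nesting vn c * b ^ nesting vN c).
Proof.
move=> /allP fx en b0 eN; apply: (@time_bound vn vN n.+1 b (mod_vars c)) => //.
- by move=> u /fx/andP[].
- by move=> u /fx/andP[].
- by rewrite en.
Qed.

Lemma time_c_all : time c_all (start w) + 3 <=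
  (weight c_all + 3) * (n.+1 ^ 3 * period M K).
Proof.
have [A [_ es [eN _] _ _]] := prepare_ok.
have np := env_n es.
have N0 : 0 < period M K by rewrite expn_gt0.
have t1 := @fixed_time c_input s_read (period M K) isT n_s_read N0
             (fun h : false => match notF h with end).
have t2 := @fixed_time c_prepare s_input (period M K) isT n_s_input N0
             (fun h : false => match notF h with end).
have t3 := @fixed_time c_main s_prepared (period M K) isT np N0
             (fun=> eq_leq eN).
have W : weight c_all = 2 + (weight c_input + (weight c_prepare + weight c_main)) by [].
have d1 : nesting vn c_input = 2 by [].
have d2 : nesting vn c_prepare = 1 by [].
have d3 : nesting vn c_main = 3 by [].
have e1 : nesting vN c_input = 0 by [].
have e2 : nesting vN c_prepare = 0 by [].
have e3 : nesting vN c_main = 1 by [].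
rewrite d1 e1 in t1; rewrite d2 e2 in t2; rewrite d3 e3 expn1 in t3.
have le a : a <= 3 -> n.+1 ^ a * period M K ^ 0 <= n.+1 ^ 3 * period M K.
  by move=> h; apply: leq_mul => //; rewrite leq_pexp2l.
have {}t1 := leq_trans t1 (leq_mul (leqnn _) (le 2 isT)).
have {}t2 := leq_trans t2 (leq_mul (leqnn _) (le 1 isT)).
have F0 : 0 < n.+1 ^ 3 * period M K by rewrite muln_gt0 expn_gt0.
rewrite time_c_all_eq W; clear -t1 t2 t3 F0.
move: (n.+1 ^ 3 * period M K) F0 t1 t2 t3 => F F0.
move: (time _ _) (time _ _) (time _ _) (weight _) (weight _) (weight _).
by move=> a b c x y z; nia.
Qed.

Lemma period_le : period M K <= 16 ^ #|M|.
Proof.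
rewrite /period !cnt_card (_ : 16 = 2 ^ 4) // -expnM leq_exp2l //.
have cK : #|K| <= 2 * #|M|.
  case: (leqP #|~: M| #|M|) => h.
    apply: leq_trans (max_card _) _; rewrite -(cardsC M) mul2n -addnn.
    by rewrite leq_add2l.
  rewrite (_ : K = M) ?leq_pmull //; apply/setP => v.
  by rewrite inE leqNgt h orbF.
by lia.
Qed.

Lemma bitlen_lt a m : 0 < m -> a < 2 ^ m -> bitlen a <= m.
Proof.
move=> m0 lta; rewrite /bitlen; case: (posnP a) => [->|a0]; first by rewrite trunc_log0.
rewrite -(@ltn_exp2l 2) //; apply: leq_ltn_trans lta; exact: trunc_logP.
Qed.

Lemma lt_bitlen a : a < 2 ^ bitlen a.
Proof. exact: trunc_log_ltn. Qed.

Lemma input_size_ge : n + bitlen l + 1 <= input_size w.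
Proof.
have sz (u : seq nat) : size u <= \sum_(a <- u) bitlen a.
  by elim: u => [|a u IHu]; rewrite ?big_nil // big_cons /= -add1n leq_add.
rewrite /input_size encodeE !big_cons big_cat /=.
have := sz (set_bits M); rewrite size_set_bits.
by have : 0 < bitlen n by []; lia.
Qed.

Lemma bitlen_cp : bitlen (64 * cp (run c_all (start w)) + 128) <= 10 * input_size w.
Proof.
have iz := input_size_ge.
apply: leq_trans (_ : 4 * n + bitlen l + 10 <= _); last by lia.
apply: bitlen_lt; first by lia.
have h := cp_c_all; have hl := lt_bitlen l.
have n2 : n.+1 <= 2 ^ n by apply: ltn_expl.
have e8 : 8 ^ n = 2 ^ n * 2 ^ n * 2 ^ n by rewrite -!expnMn.
have -> : 2 ^ (4 * n + bitlen l + 10) =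
    (2 ^ n * 2 ^ n * 2 ^ n * 2 ^ n) * 2 ^ bitlen l * 1024.
  by rewrite (_ : 1024 = 2 ^ 10) // -!expnD; congr (2 ^ _); lia.
have P0 : 0 < 2 ^ bitlen l by rewrite expn_gt0.
move: (cp _) h => C h; rewrite e8 in h.
move: (2 ^ n) (2 ^ bitlen l) n2 hl P0 h => p q n2 hl q0 h {e8 iz}.
have p0 : 0 < p by lia.
have h1 : n.+1 * (p * p * p) <= p * p * p * p by nia.
have h2 : n * n + n <= p * p * p * p by nia.
have h3 : n <= p * p * p * p by nia.
have h4 : C <= 3 * (p * p * p * p) + q by lia.
have r0 : 0 < p * p * p * p by rewrite !muln_gt0 p0.
by move: (p * p * p * p) r0 h4 => r r0 h4; nia.
Qed.

End Whole.

Theorem theorem5 :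
  exists (P : program) (a d : nat),
    forall (n : nat) (G : sgraph 'I_n) (l : nat) (M : {set 'I_n}),
      clique_modulator G M ->
      exists (b : bool) (t : nat),
        [/\ halts_on P (encode G l M) b t,
            b <-> has_dominator_coloring G l
          & t <= a * 16 ^ #|M| * input_size (encode G l M) ^ d].
Proof.
exists (program_of c_all vres), ((weight c_all + 3) * 20), 4.
move=> n G l M cM; set w := encode G l M.
have [t ht let_] := @program_of_halts c_all vres w isT isT.
exists (0 < vr (run c_all (start w)) vres), t; split=> //; first exact: c_all_ok.
apply: leq_trans let_ _.
have t1 := time_c_all G l M; have t2 := bitlen_cp G l M; have t3 := period_le M.
have t4 := input_size_ge G l M.
rewrite -/w in t1 t2 t4.
apply: leq_trans (leq_mul t1 (leq_mul (leqnn 2) t2)) _.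
have t5 : n.+1 ^ 3 <= input_size w ^ 3 by rewrite leq_exp2r //; lia.
apply: leq_trans (leq_mul (leq_mul (leqnn _) (leq_mul t5 t3)) (leqnn _)) _.
apply: eq_leq; rewrite (expnS (input_size w) 3); move: (weight _ + 3) (16 ^ _).
by move: (input_size w ^ 3) (input_size w) => x y z u; lia.
Qed.
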